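(* Let $(M,g)$ be an oriented Riemannian $4$-manifold and let $h$ be another Riemannian metric on $M$. Then the following are equivalent: 1. $\mathrm{Rm}_g(\Lambda^+_h,\Lambda^-_h)=0$. 2. $*_h\,\hat R_{g\text{-}h}=\hat R_{g\text{-}h}\,*_h$. 3. $\sigma_{g\text{-}h}(P)=\sigma_{g\text{-}h}( *_hP)$ for every $p\in M$ and every $2$-plane $P\in \mathrm{Gr}_2(T_pM)$. 4. $\mathrm{Ric}_{g\text{-}h}=\dfrac{\mathrm{scal}_{g\text{-}h}}{4}\,h$.
   Context: Manifolds and metrics are smooth. For the Riemannian metric $h$ on the oriented $4$-manifold $M$, the bundle $\Lambda^2=\Lambda^2(TM)$ carries the inner product determined by $\langle v\wedge w,x\wedge y\rangle_h=h(v,x)h(w,y)-h(v,y)h(w,x)$. With $dV_h\in\Lambda^4(TM)$ the positively oriented $h$-unit element, the Hodge star $*_h:\Lambda^2\to\Lambda^2$ is defined by $\xi\wedge *_h\eta=\langle\xi,\eta\rangle_h\,dV_h$, and $\Lambda^\pm_h$ denote its $\pm1$-eigenspaces. The curvature tensor of $g$ is $\mathrm{Rm}_g(v,w,x,y)=g(\nabla_v\nabla_w x-\nabla_w\nabla_v x-\nabla_{[v,w]}x,\,y)$, with $\nabla$ the Levi-Civita connection of $g$, viewed as a symmetric bilinear form on $\Lambda^2$ via $\mathrm{Rm}_g(v\wedge w,x\wedge y)=\mathrm{Rm}_g(v,w,x,y)$. The condition $\mathrm{Rm}_g(\Lambda^+_h,\Lambda^-_h)=0$ means $\mathrm{Rm}_g(\xi,\eta)=0$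 at every point for all $\xi\in\Lambda^+_h$, $\eta\in\Lambda^-_h$. The endomorphism $\hat R_{g\text{-}h}:\Lambda^2\to\Lambda^2$ is defined by $\langle\hat R_{g\text{-}h}(v\wedge w),x\wedge y\rangle_h:=\mathrm{Rm}_g(v,w,x,y)$ (curvature of $g$, inner product of $h$). Here $\mathrm{Gr}_2(T_pM)$ is identified with the set of $\langle\cdot,\cdot\rangle_h$-unit decomposable bivectors in $\Lambda^2(T_pM)$, and $\sigma_{g\text{-}h}(P):=\langle\hat R_{g\text{-}h}P,P\rangle_h$. In an oriented $h$-orthonormal frame $\{e_1,\dots,e_4\}$, with $R_{ijkl}:=\mathrm{Rm}_g(e_i,e_j,e_k,e_l)$, the mixed Ricci tensor and mixed scalar curvature are $(\mathrm{Ric}_{g\text{-}h})_{jl}:=\sum_{i=1}^4R_{ijli}$ and $\mathrm{scal}_{g\text{-}h}:=\sum_{j=1}^4(\mathrm{Ric}_{g\text{-}h})_{jj}$. *)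

(* Defs.v *)
From HB Require Import structures.
From mathcomp Require Import all_boot all_order all_algebra all_fingroup.
From mathcomp Require Import all_classical all_reals all_analysis.

Set Implicit Arguments.
Unset Strict Implicit.
Unset Printing Implicit Defensive.

Import Order.TTheory GRing.Theory Num.Theory.
Import numFieldNormedType.Exports.

Local Open Scope classical_set_scope.
Local Open Scope ring_scope.

Section Smooth.
Context {R : realType} {n : nat}.
Implicit Types (U : set 'rV[R]_n) (f : 'rV[R]_n -> R).

(* Only meant for open [U]: the derivatives are taken in the ambient space. *)
Fixpoint Ck_on (k : nat) U f : Prop :=
  if k is k'.+1 then
    forall i : 'I_n, (forall x, U x -> derivable f x (delta_mx 0 i)) /\
                     Ck_on k' U (fun x => 'D_(delta_mx 0 i) f x)
  else forall x, U x -> {for x, continuous f}.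

Definition smooth_on U f := forall k, Ck_on k U f.

End Smooth.

(* Both maps of a chart are total; they are irrelevant outside [chart_dom],
   respectively outside its image. *)
Record chart (R : realType) (n : nat) (M : topologicalType) := Chart {
  chart_dom : set M;
  chart_map : M -> 'rV[R]_n;
  chart_inv : 'rV[R]_n -> M;
  chart_dom_open : open chart_dom;
  chart_img_open : open (chart_map @` chart_dom);
  chart_mapK : forall p, chart_dom p -> chart_inv (chart_map p) = p;
  chart_map_continuous :
    forall p, chart_dom p -> {for p, continuous chart_map};
  chart_inv_continuous :
    forall y, (chart_map @` chart_dom) y -> {for y, continuous chart_inv}
}.

Section Transition.
Context {R : realType} {n : nat} {M : topologicalType}.
Implicit Types a b : chart R n M.

Definition chart_img a := chart_map a @` chart_dom a.

Definition transition a b : 'rV[R]_n -> 'rV[R]_n :=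
  chart_map b \o chart_inv a.

(* Tangent vectors are rows: the vector with coordinates [v] in the chart [a]
   has coordinates [v *m transition_jac a b p] in the chart [b]. *)
Definition transition_jac a b (p : M) : 'M[R]_n :=
  'J (transition a b) (chart_map a p).

End Transition.

(* The tangent space at [p] is ['rV[R]_n], a tangent vector being identified
   with its coordinates in the chart [chart_at p]; which chart of the atlas is
   used at [p] is immaterial. *)
Record oriented_manifold (R : realType) (n : nat) := OrientedManifold {
  points :> topologicalType;
  points_hausdorff : hausdorff_space points;
  points_second_countable : @second_countable points;
  atlas : set (chart R n points);
  chart_at : points -> chart R n points;
  chart_at_atlas : forall p, atlas (chart_at p);
  chart_at_dom : forall p, chart_dom (chart_at p) p;
  transition_smooth : forall a b, atlas a -> atlas b -> forall j : 'I_n,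
    smooth_on (chart_map a @` (chart_dom a `&` chart_dom b))
              (fun y => transition a b y 0 j);
  transition_oriented : forall a b, atlas a -> atlas b -> forall p,
    chart_dom a p -> chart_dom b p -> 0 < \det (transition_jac a b p)
}.

Section Calculus.
Context {R : realType} {n : nat} {M : oriented_manifold R n}.

Definition vfield := M -> 'rV[R]_n.

Implicit Types (f : M -> R) (X Y : vfield) (p : M) (c : chart R n M).

Definition smooth_fun f := forall c, atlas c ->
  smooth_on (chart_img c) (f \o chart_inv c).

(* The components of [X] in the chart [c], as a function of the coordinates. *)
Definition in_chart c X : 'rV[R]_n -> 'rV[R]_n := fun y =>
  let q := chart_inv c y in X q *m transition_jac (chart_at q) c q.

Definition smooth_vfield X := forall c, atlas c -> forall i : 'I_n,
  smooth_on (chart_img c) (fun y => in_chart c X y 0 i).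

(* The i-th coordinate vector of the chart [c], at the point [p]. *)
Definition coord_vector c p (i : 'I_n) : 'rV[R]_n :=
  delta_mx 0 i *m transition_jac c (chart_at p) p.

Definition dir_deriv X f : M -> R := fun p =>
  'D_(X p) (f \o chart_inv (chart_at p)) (chart_map (chart_at p) p).

Definition lie_bracket X Y : vfield := fun p =>
  let c := chart_at p in
  'D_(X p) (in_chart c Y) (chart_map c p)
  - 'D_(Y p) (in_chart c X) (chart_map c p).

End Calculus.

Arguments vfield {R n} M.

Record metric (R : realType) (n : nat) (M : oriented_manifold R n) := Metric {
  inner :> M -> 'rV[R]_n -> 'rV[R]_n -> R;
  innerC : forall p v w, inner p v w = inner p w v;
  inner_linear : forall p a u v w,
    inner p (a *: u + v) w = a * inner p u w + inner p v w;
  inner_gt0 : forall p v, v != 0 -> 0 < inner p v v;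
  inner_smooth : forall c, atlas c -> forall i j : 'I_n,
    smooth_on (chart_img c) (fun y => let q := chart_inv c y in
      inner q (coord_vector c q i) (coord_vector c q j))
}.

Section Curvature.
Context {R : realType} {n : nat} {M : oriented_manifold R n}.
Implicit Types (X Y Z : vfield M) (f : M -> R) (g : metric M).

(* Operations on vector fields are total functions, but constrained on smooth
   arguments only. *)
Record affine_connection (nabla : vfield M -> vfield M -> vfield M) : Prop :=
  AffineConnection {
  connection_smooth : forall X Y, smooth_vfield X -> smooth_vfield Y ->
    smooth_vfield (nabla X Y);
  connection_linear : forall f X X' Y, smooth_fun f ->
    smooth_vfield X -> smooth_vfield X' -> smooth_vfield Y -> forall p,
    nabla (fun q => f q *: X q + X' q) Y p = f p *: nabla X Y p + nabla X' Y p;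
  connection_additive : forall X Y Y',
    smooth_vfield X -> smooth_vfield Y -> smooth_vfield Y' -> forall p,
    nabla X (fun q => Y q + Y' q) p = nabla X Y p + nabla X Y' p;
  connection_leibniz : forall f X Y, smooth_fun f ->
    smooth_vfield X -> smooth_vfield Y -> forall p,
    nabla X (fun q => f q *: Y q) p
      = dir_deriv X f p *: Y p + f p *: nabla X Y p
}.

Record levi_civita g (nabla : vfield M -> vfield M -> vfield M) : Prop :=
  LeviCivita {
  levi_civita_connection : affine_connection nabla;
  levi_civita_torsion_free : forall X Y,
    smooth_vfield X -> smooth_vfield Y -> forall p,
    nabla X Y p - nabla Y X p = lie_bracket X Y p;
  levi_civita_metric : forall X Y Z,
    smooth_vfield X -> smooth_vfield Y -> smooth_vfield Z -> forall p,
    dir_deriv X (fun q => g q (Y q) (Z q)) p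
      = g p (nabla X Y p) (Z p) + g p (Y p) (nabla X Z p)
}.

Variables (g : metric M) (nabla : vfield M -> vfield M -> vfield M).

Definition curvature X Y Z : vfield M := fun p =>
  nabla X (nabla Y Z) p - nabla Y (nabla X Z) p - nabla (lie_bracket X Y) Z p.

(* A smooth vector field with value [v] at [p]. *)
Definition extension (p : M) (v : 'rV[R]_n) : vfield M :=
  xget (fun=> 0) [set X | smooth_vfield X /\ X p = v].

(* Independent of the chosen extensions, by tensoriality. *)
Definition Rm (p : M) (v w x y : 'rV[R]_n) : R :=
  g p (curvature (extension p v) (extension p w) (extension p x) p) y.

End Curvature.

(* The exterior square of ['rV[R]_n], realized as the antisymmetric matrices:
   the matrix [xi] stands for the sum over [i < j] of
   [xi i j *: (e_i /\ e_j)]. *)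
Section Bivectors.
Context {R : realType} {n : nat}.

Definition antisym : {pred 'M[R]_n} := [pred A | A^T == - A].

Fact antisym_submod_closed : submod_closed antisym.
Proof.
split=> [|a A B /eqP hA /eqP hB]; first by rewrite inE trmx0 oppr0.
by rewrite inE linearP /= hA hB opprD scalerN.
Qed.

HB.instance Definition _ :=
  GRing.isSubmodClosed.Build R 'M[R]_n antisym antisym_submod_closed.

Record bivector := Bivector { bivector_mx :> 'M[R]_n; _ : bivector_mx \in antisym }.

HB.instance Definition _ := [isSub for bivector_mx].
HB.instance Definition _ := [Choice of bivector by <:].
HB.instance Definition _ := [SubChoice_isSubLmodule of bivector by <:].

Fact wedge_subproof (v w : 'rV[R]_n) : v^T *m w - w^T *m v \in antisym.
Proof. by rewrite inE linearB /= !trmx_mul !trmxK opprB. Qed.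

Definition wedge (v w : 'rV[R]_n) : bivector := Bivector (wedge_subproof v w).

(* For [T] multilinear and antisymmetric in its first and in its last two
   arguments, the bilinear form on bivectors whose value at
   [wedge v w], [wedge x y] is [T v w x y]. *)
Definition bivector_form (T : 'rV[R]_n -> 'rV[R]_n -> 'rV[R]_n -> 'rV[R]_n -> R)
    (xi eta : bivector) : R :=
  4^-1 * \sum_i \sum_j \sum_k \sum_l xi i j * eta k l *
    T (delta_mx 0 i) (delta_mx 0 j) (delta_mx 0 k) (delta_mx 0 l).

End Bivectors.

Arguments bivector R n : clear implicits.

(* The fourth exterior power of ['rV[R]_4] is identified with [R] through its
   basis [e_0 /\ e_1 /\ e_2 /\ e_3], which is positive because the charts are;
   [wedge4 (wedge v w) (wedge x y)] is the determinant of the rows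
   [v], [w], [x], [y]. *)
Definition wedge4 (R : realType) (xi eta : bivector R 4) : R :=
  let o i := @Ordinal 4 i in
  4^-1 * \sum_(s : 'S_4) (-1) ^+ s *
    xi (s (o 0%N isT)) (s (o 1%N isT)) * eta (s (o 2%N isT)) (s (o 3%N isT)).

Section Mixed.
Context {R : realType} {M : oriented_manifold R 4}.
Variable h : metric M.

Definition bivector_inner (p : M) : bivector R 4 -> bivector R 4 -> R :=
  bivector_form (fun v w x y => h p v x * h p w y - h p v y * h p w x).

(* The Gram determinant is the squared norm of [e_0 /\ e_1 /\ e_2 /\ e_3]. *)
Definition dV (p : M) : R :=
  (Num.sqrt (\det (\matrix_(i < 4, j < 4)
                     h p (delta_mx 0 i) (delta_mx 0 j))))^-1.

Definition hodge (p : M) (eta : bivector R 4) : bivector R 4 :=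
  xget 0 [set zeta | forall xi,
    wedge4 xi zeta = bivector_inner p xi eta * dV p].

Definition self_dual (p : M) (xi : bivector R 4) := hodge p xi = xi.

Definition anti_self_dual (p : M) (xi : bivector R 4) := hodge p xi = - xi.

(* A 2-plane is encoded by either of its two unit decomposable bivectors. *)
Definition Gr2 (p : M) : set (bivector R 4) :=
  [set P | (exists v w, P = wedge v w) /\ bivector_inner p P P = 1].

Definition oriented_orthonormal (p : M) (e : 'I_4 -> 'rV[R]_4) :=
  (forall i j, h p (e i) (e j) = (i == j)%:R) /\
  0 < \det (\matrix_(i < 4) e i).

Variables (g : metric M) (nabla : vfield M -> vfield M -> vfield M).

Definition Rm_form (p : M) : bivector R 4 -> bivector R 4 -> R :=
  bivector_form (Rm g nabla p).

Definition mixed_curvature_op (p : M) (xi : bivector R 4) : bivector R 4 :=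
  xget 0 [set zeta | forall eta,
    bivector_inner p zeta eta = Rm_form p xi eta].

Definition mixed_sec (p : M) (P : bivector R 4) : R :=
  bivector_inner p (mixed_curvature_op p P) P.

Definition mixed_Ric (p : M) (e : 'I_4 -> 'rV[R]_4) (j l : 'I_4) : R :=
  \sum_i Rm g nabla p (e i) (e j) (e l) (e i).

Definition mixed_scal (p : M) (e : 'I_4 -> 'rV[R]_4) : R :=
  \sum_j mixed_Ric p e j j.

End Mixed.

(* Main.v *)
(* Only pointwise linear algebra separates the four conditions, once [Rm] is
   known to be an algebraic curvature tensor.

   Tensoriality of the curvature is obtained without a partition of unity: for a
   bump function [f] supported in a chart with [f p = 1], the field [f ^+ 2 *: X]
   is globally a combination, with smooth coefficients, of the fields
   [f *: coord_vector c _ i], so an operator linear over smooth functions only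
   sees [X p].  The Jacobi identity behind the Bianchi identity is read off from
   the action of vector fields on functions, [X, Y] f = X (Y f) - Y (X f), which
   is Schwarz's theorem in a chart.

   At a point, let [w] be the basis of bivectors given by the coordinate planes
   01, 02, 03, 23, 31, 12 of an oriented [h]-orthonormal frame.  The Hodge star
   exchanges [w k] and [w (k + 3 mod 6)], and each of the four conditions amounts
   to [Rm (w i) (w j) = Rm ( * w i) ( * w j)] for all [i], [j].  For the third
   one, apply it to [w i] and to [(w i + w j) / sqrt 2], which is decomposable as
   soon as [w i] and [w j] share a direction; for the fourth one, the traceless
   Ricci tensor has nine independent components, which are exactly the
   differences of both sides. *)
From HB Require Import structures.
Require Import Defs.
From mathcomp Require Import all_boot all_order all_algebra all_fingroup.
From mathcomp Require Import all_classical all_reals all_analysis.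
From mathcomp Require Import ring lra.

Set Implicit Arguments.
Unset Strict Implicit.
Unset Printing Implicit Defensive.

Import Order.TTheory GRing.Theory Num.Theory.
Import numFieldNormedType.Exports.

Local Open Scope classical_set_scope.
Local Open Scope ring_scope.

(** * Calculus on row vectors *)

(** [extension], [hodge] and [mixed_curvature_op] are obtained by choice, with a default value when
    no candidate exists, so nothing can be said about them before existence is proved: by fields
    built from a bump function for the first, by coordinates in an orthonormal frame for the other
    two. Smoothness is given only by iterated coordinate derivatives; differentiability, the chain
    rule and the symmetry of second derivatives have to be recovered from the continuity of partial
    derivatives. The connection is constrained on global smooth fields alone, which is why every
    local object has to be cut off.

    On the algebraic side, the Bianchi identity enters through the pair symmetry of [Rm]. Of the
    fifteen pairs of distinct coordinate planes, the three pairs of a plane and its dual satisfy the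
    required equality by this symmetry; the other twelve form six couples exchanged by the star.
    Together with the three couples on the diagonal they give the nine equations that match the
    traceless Ricci tensor. *)

Lemma differential_eps (R : realType) (V W : normedModType R) (f : V -> W)
    (df : {linear V -> W}) (x : V) : continuous df ->
  (forall eps : R, 0 < eps ->
     \forall h \near 0, `|f (h + x) - (f x + df h)| <= eps * `|h|) ->
  differentiable f x /\ 'd f x = df :> (V -> W).
Proof.
move=> cdf fdf.
have E : f \o shift x = cst (f x) + df +o_ 0 id by exact/eqaddoP.
have D := diff_unique cdf E.
by split=> //; apply/diff_locallyP; rewrite D.
Qed.

Section C1.
Context {R : realType} {n : nat}.
Implicit Types (f : 'rV[R]_n -> R) (x y v w : 'rV[R]_n).

Local Notation e_ i := (delta_mx 0 i : 'rV[R]_n).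

Lemma is_derive_line f x v (t : R) : derivable f (x + t *: v) v ->
  is_derive t 1 (fun s : R => f (x + s *: v)) ('D_v f (x + t *: v)).
Proof.
move=> df.
have E : (fun h : R => h^-1 *: (((fun s : R => f (x + s *: v)) \o shift t) (h *: 1)
             - f (x + t *: v))) =
         (fun h : R => h^-1 *: ((f \o shift (x + t *: v)) (h *: v) - f (x + t *: v))).
  apply/funext => h /=; rewrite [h *: 1]mulr1.
  by congr (_ *: (f _ - _)); rewrite scalerDl addrCA.
apply: DeriveDef; first by rewrite /derivable E.
by rewrite /derive E.
Qed.

(** The length [c] may be negative, since it will be a coordinate of an arbitrary increment; the
    symmetric hypothesis on [t] covers both [[0, c]] and [[c, 0]]. *)
Lemma mean_value_line f x v (c : R) :
  (forall t : R, `|t| <= `|c| -> derivable f (x + t *: v) v) ->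
  exists2 t : R, `|t| <= `|c| &
    f (x + c *: v) - f x = c * 'D_v f (x + t *: v).
Proof.
move=> df.
pose g := fun s : R => f (x + s *: v).
have dg (t : R) : `|t| <= `|c| -> is_derive t 1 g ('D_v f (x + t *: v)).
  by move=> tc; apply: is_derive_line; exact: df.
have cg (a b : R) : (forall t, t \in `[a, b]%R -> `|t| <= `|c|) ->
    {within `[a, b], continuous g}.
  move=> ab; apply: derivable_within_continuous => t tab.
  by have [] := dg t (ab t tab).
have [c0|c0] := leP 0 c.
  have sub (t : R) : t \in `[0, c]%R -> `|t| <= `|c|.
    by rewrite in_itv /= => /andP[t0 tc]; rewrite !ger0_norm.
  have [|t tc E] := @MVT_segment R g (fun t => 'D_v f (x + t *: v)) 0 c c0 _ (cg 0 c sub).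
    by move=> t tc; apply: dg; apply: sub; apply: subset_itvW tc.
  exists t; first exact: sub.
  by move: E; rewrite /g scale0r addr0 subr0 mulrC.
have sub (t : R) : t \in `[c, 0]%R -> `|t| <= `|c|.
  by rewrite in_itv /= => /andP[tc t0]; rewrite !ler0_norm ?lerN2 // ltW.
have [|t tc E] := @MVT_segment R g (fun t => 'D_v f (x + t *: v)) c 0 (ltW c0) _ (cg c 0 sub).
  by move=> t tc; apply: dg; apply: sub; apply: subset_itvW tc.
exists t; first exact: sub.
move: E; rewrite /g scale0r addr0 sub0r => E.
by rewrite -[LHS]opprB E mulrN opprK mulrC.
Qed.

Lemma rV_norm_le v (d : R) : 0 <= d -> (forall i, `|v 0 i| <= d) -> `|v| <= d.
Proof.
move=> d0 vd; rewrite /Num.Def.normr /= mx_normrE.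
by apply: bigmax_le => // -[i j] _ /=; rewrite ord1.
Qed.

Lemma rV_coord_le v i : `|v 0 i| <= `|v|.
Proof.
rewrite [leRHS]/Num.Def.normr /= mx_normrE.
exact: (le_bigmax _ (fun i : 'I_1 * 'I_n => `|v i.1 i.2|) (0, i)).
Qed.

Definition grad f x v : R := \sum_i v 0 i * 'D_(e_ i) f x.

Fact grad_is_linear f x : linear (grad f x).
Proof.
move=> a u v; rewrite /grad scaler_sumr -big_split /=; apply: eq_bigr => i _.
by rewrite !mxE mulrDl -[a *: _]/(a * _) mulrA.
Qed.

HB.instance Definition _ f x :=
  GRing.isLinear.Build R 'rV[R]_n R *:%R (grad f x) (@grad_is_linear f x).

Lemma grad_continuous f x : continuous (grad f x).
Proof.
rewrite /grad; apply: continuous_big => [|i _ v]; first exact: add_continuous.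
apply: (@continuousM R 'rV[R]_n (fun u => u 0 i) (cst ('D_(e_ i) f x)) v).
  exact: (@coord_continuous R 1 n 0 i v).
exact: cst_continuous.
Qed.

(** Successive truncations lead from [0] to [h] in [n] moves, each along a single basis vector,
    where the one-variable mean value theorem applies. *)
Let trunc (h : 'rV[R]_n) (k : nat) : 'rV[R]_n :=
  \row_i if (i < k)%N then h 0 i else 0.

Let truncS h (i : 'I_n) : trunc h i.+1 = trunc h i + h 0 i *: e_ i.
Proof.
apply/rowP => j; rewrite !mxE /= ltnS leq_eqVlt.
have [->|ji] := eqVneq j i; first by rewrite eqxx ltnn /= mulr1 add0r.
by rewrite (negbTE (_ : (j : nat) != i)) //= mulr0 addr0.
Qed.

(** The increment of [f] telescopes over the truncations of [h], and each term is a partial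
    derivative at an intermediate point. Those points stay in the ball because the norm is the sup
    norm, which truncation does not increase; continuity of the partials at [x] then bounds the
    error. *)
Lemma C1_diff f x :
  (forall i, \forall y \near x, derivable f y (e_ i)) ->
  (forall i, {for x, continuous ('D_(e_ i) f)}) ->
  differentiable f x /\ 'd f x = grad f x :> (_ -> _).
Proof.
move=> df cf; apply: differential_eps => [|eps eps0].
  exact: grad_continuous.
(* Each of the [n] moves may contribute an error [e] times the norm of [h]; dividing by [n.+1] keeps
   [e] positive even for [n = 0]. *)
pose e := eps / n.+1%:R.
have e0 : 0 < e by rewrite divr_gt0 // ltr0n.
have near_i i : \forall y \near x,
    derivable f y (e_ i) /\ `|'D_(e_ i) f x - 'D_(e_ i) f y| < e.
  apply: filterI; first exact: df.
  by have /cvgrPdist_lt := cf i; apply.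
have /nbhs_ballP[d /= d0 xd] : \forall y \near x, forall i,
    derivable f y (e_ i) /\ `|'D_(e_ i) f x - 'D_(e_ i) f y| < e.
  exact: filter_forall near_i.
near=> h.
have hd : `|h| < d.
  have : ball 0 d h by near: h; exact: nbhsx_ballx.
  by rewrite -ball_normE /= sub0r normrN.
have step (i : 'I_n) : exists2 z, ball x d z &
   f (x + trunc h i.+1) - f (x + trunc h i) = h 0 i * 'D_(e_ i) f z.
  have inb (t : R) : `|t| <= `|h 0 i| -> ball x d (x + trunc h i + t *: e_ i).
    move=> th; rewrite -ball_normE /= -addrA opprD addrA subrr sub0r normrN.
    apply: le_lt_trans hd; apply: rV_norm_le => // j; rewrite !mxE /=.
    have [->|ji] := eqVneq j i.
      by rewrite ltnn add0r mulr1 (le_trans th) // rV_coord_le.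
    rewrite mulr0 addr0; case: ifP => _; first exact: rV_coord_le.
    by rewrite normr0.
  have [|t th E] := @mean_value_line f (x + trunc h i) (e_ i) (h 0 i).
    by move=> t /inb /xd /(_ i) [].
  exists (x + trunc h i + t *: e_ i); first exact: inb.
  by rewrite truncS addrA E.
have tele : f (h + x) - f x = \sum_(i < n) (f (x + trunc h i.+1) - f (x + trunc h i)).
  rewrite -(big_mkord predT (fun i => f (x + trunc h i.+1) - f (x + trunc h i))).
  rewrite telescope_sumr //; congr (f _ - f _).
    by rewrite addrC; congr (_ + _); apply/rowP => i; rewrite !mxE ltn_ord.
  by rewrite -[LHS]addr0; congr (_ + _); apply/rowP => i; rewrite !mxE ltn0.
rewrite opprD addrA tele /grad.
rewrite -sumrB (le_trans (ler_norm_sum _ _ _)) //.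
apply: (@le_trans _ _ (\sum_(i < n) e * `|h|)).
  apply: ler_sum => i _; have [z zd ->] := step i.
  rewrite -mulrBr normrM mulrC; apply: ler_pM => //; last exact: rV_coord_le.
  by rewrite distrC ltW //; have [] := xd z zd i.
rewrite sumr_const card_ord -mulr_natr mulrAC ler_wpM2r //.
by rewrite /e mulrAC ler_pdivrMr ?ltr0n // ler_pM2l // ler_nat.
Unshelve. all: by end_near. Qed.

(** The mean value theorem is used twice: along [v] for [F y = f (y + s *: w) - f y], whose
    derivative is an increment of ['D_v f], then along [w] for ['D_v f] itself. *)
Lemma second_difference f x v w (d s : R) : 0 < s ->
  (forall t u : R, `|t| <= s -> `|u| <= s -> `|t *: v + u *: w| < d) ->
  (forall y, ball x d y -> derivable f y v) ->
  (forall y, ball x d y -> derivable ('D_v f) y w) ->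
  exists2 z, ball x d z &
    f (x + s *: v + s *: w) - f (x + s *: v) - f (x + s *: w) + f x
      = s ^+ 2 * 'D_w ('D_v f) z.
Proof.
move=> s0 small dv dw.
have ns : `|s| = s by rewrite gtr0_norm.
have inb (t u : R) : `|t| <= s -> `|u| <= s -> ball x d (x + t *: v + u *: w).
  move=> ts us; rewrite -ball_normE /= -addrA opprD addrA subrr sub0r normrN.
  exact: small.
pose F y := f (y + s *: w) - f y.
have dF (t : R) : `|t| <= s -> is_derive (x + t *: v) v F
   ('D_v f (x + t *: v + s *: w) - 'D_v f (x + t *: v)).
  move=> ts; rewrite /F; apply: is_deriveB; last first.
    apply/derivableP/dv; have := inb t 0 ts; rewrite scale0r addr0; apply.
    by rewrite normr0 ltW.
  have D : derivable f (x + t *: v + s *: w) v by apply/dv/inb; rewrite ?ns.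
  have E : (fun h : R => h^-1 *: (((fun y => f (y + s *: w)) \o shift (x + t *: v)) (h *: v)
             - f (x + t *: v + s *: w))) =
           (fun h : R => h^-1 *: ((f \o shift (x + t *: v + s *: w)) (h *: v)
              - f (x + t *: v + s *: w))).
    by apply/funext => h /=; rewrite !addrA.
  apply: DeriveDef; first by rewrite /derivable E.
  by rewrite /derive E.
have [|t] := @mean_value_line F x v s.
  by move=> t; rewrite ns => /dF [].
rewrite ns => ts; have [_ ->] := dF t ts => EF.
have [|u] := @mean_value_line ('D_v f) (x + t *: v) w s.
  by move=> u; rewrite ns => us; apply/dw/inb.
rewrite ns => us E2.
exists (x + t *: v + u *: w); first exact: inb.
by rewrite expr2 -mulrA -E2 -EF /F opprB addrA addrAC.
Qed.

(** The second difference is symmetric in [v] and [w], so the two mixed derivatives take a common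
    value at points [z1] and [z2] arbitrarily close to [x]; continuity brings both back to [x]. *)
Lemma schwarz f x v w :
  (\forall y \near x, derivable f y v /\ derivable ('D_v f) y w) ->
  (\forall y \near x, derivable f y w /\ derivable ('D_w f) y v) ->
  {for x, continuous ('D_w ('D_v f))} -> {for x, continuous ('D_v ('D_w f))} ->
  'D_w ('D_v f) x = 'D_v ('D_w f) x.
Proof.
move=> dvw dwv cvw cwv; apply/eqP; rewrite -subr_eq0 -normr_le0.
apply/ler_addgt0Pl => eps eps0; rewrite addr0.
have e0 : 0 < eps / 2 by rewrite divr_gt0.
have /cvgrPdist_lt /(_ _ e0) cvw' := cvw.
have /cvgrPdist_lt /(_ _ e0) cwv' := cwv.
have /nbhs_ballP[d /= d0 xd] : \forall y \near x,
    ((derivable f y v /\ derivable ('D_v f) y w) /\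
     (derivable f y w /\ derivable ('D_w f) y v)) /\
    `|'D_w ('D_v f) x - 'D_w ('D_v f) y| < eps / 2 /\
    `|'D_v ('D_w f) x - 'D_v ('D_w f) y| < eps / 2.
  apply: filterS (filterI (filterI dvw dwv) (filterI cvw' cwv')) => y [dd cc].
  exact: (conj dd cc).
(* The summand [1] keeps [m] positive when [v] and [w] vanish; with [s * m = d / 2], all corners of
   the parallelogram remain within distance [d]. *)
pose m := `|v| + `|w| + 1.
have m0 : 0 < m by rewrite /m ltr_wpDl // addr_ge0.
pose s := d / 2 / m.
have s0 : 0 < s by rewrite !divr_gt0.
have small (a b : 'rV[R]_n) : `|a| + `|b| + 1 = m -> forall t u : R,
    `|t| <= s -> `|u| <= s -> `|t *: a + u *: b| < d.
  move=> mE t u ts us; apply: le_lt_trans (_ : d / 2 < d); last by lra.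
  rewrite (le_trans (ler_normD _ _)) // !normrZ.
  apply: (@le_trans _ _ (s * m)); last by rewrite /s divfK // gt_eqF.
  rewrite -mE; apply: (@le_trans _ _ (s * `|a| + s * `|b|)).
    by apply: lerD; apply: ler_wpM2r.
  by rewrite -mulrDr ler_wpM2l ?ltW // ltrDl.
have [z1 z1d E1] := @second_difference f x v w d s s0 (small v w erefl)
  (fun y yd => (xd y yd).1.1.1) (fun y yd => (xd y yd).1.1.2).
have [z2 z2d E2] := @second_difference f x w v d s s0
  (small w v (congr1 (+%R^~ 1) (addrC _ _)))
  (fun y yd => (xd y yd).1.2.1) (fun y yd => (xd y yd).1.2.2).
have {E1 E2}E : 'D_w ('D_v f) z1 = 'D_v ('D_w f) z2.
  apply: (@mulfI _ (s ^+ 2)); first by rewrite expf_neq0 // gt_eqF.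
  rewrite -E1 -E2 (addrAC x (s *: w)); congr (_ + _); exact: addrAC.
have c1 := (xd _ z1d).2.1; have c2 := (xd _ z2d).2.2.
apply: (@le_trans _ _ (`|'D_w ('D_v f) x - 'D_w ('D_v f) z1| +
   `|'D_v ('D_w f) z2 - 'D_v ('D_w f) x|)).
  apply: le_trans (ler_normD _ _); rewrite E.
  by rewrite addrA subrK.
rewrite [leRHS]splitr; apply: lerD; first exact: (ltW c1).
rewrite distrC; exact: (ltW c2).
Qed.

End C1.

Lemma near_comp (S T : topologicalType) (f : S -> T) x (P : T -> Prop) :
  {for x, continuous f} -> (\forall z \near f x, P z) -> \forall y \near x, P (f y).
Proof. by move=> cf Pf; exact: (cf _ Pf). Qed.

(** * Smoothness at a point and its closure properties *)

Section SmoothAt.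
Context {R : realType} {n : nat}.
Implicit Types (f g : 'rV[R]_n -> R) (x y v w : 'rV[R]_n) (U : set 'rV[R]_n).

Local Notation e_ i := (delta_mx 0 i : 'rV[R]_n).

(** Every clause holds near [x], not only at [x]: the notion depends on the germ of [f] alone, so it
    passes through local equalities and needs no open set carried along. *)
Fixpoint Ck_at (k : nat) f x : Prop :=
  if k is k'.+1 then
    forall i : 'I_n, (\forall y \near x, derivable f y (e_ i)) /\
                     Ck_at k' ('D_(e_ i) f) x
  else \forall y \near x, {for y, continuous f}.

Definition smooth_at f x := forall k, Ck_at k f x.

Lemma Ck_onP k U f : open U -> Ck_on k U f <-> forall x, U x -> Ck_at k f x.
Proof.
move=> oU; have near_U (P : 'rV[R]_n -> Prop) :
    (forall x, U x -> P x) -> forall x, U x -> \forall y \near x, P y.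
  move=> UP x Ux; apply: filterS UP _.
  by apply: open_nbhs_nbhs.
elim: k f => [|k IH] f /=; split.
- exact: near_U.
- by move=> cf x /cf /nbhs_singleton.
- move=> fk x Ux i; have [df /IH] := fk i; split; last by auto.
  exact: near_U Ux.
- move=> fk i; split=> [x /fk /(_ i) [/nbhs_singleton]//|].
  by apply/IH => x /fk /(_ i) [].
Qed.

Lemma smooth_onP U f : open U -> smooth_on U f <-> forall x, U x -> smooth_at f x.
Proof.
move=> oU; split=> [sf x Ux k|sf k]; first exact: (Ck_onP k f oU).1 (sf k) x Ux.
by apply/Ck_onP => // x /sf.
Qed.

Lemma continuous_near_eq f g x : (\forall y \near x, f y = g y) ->
  {for x, continuous f} -> {for x, continuous g}.
Proof.
move=> fg; rewrite /prop_for /continuous_at -(nbhs_singleton fg).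
move=> cf; apply: cvg_trans cf; exact: (near_eq_cvg fg).
Qed.

Lemma Ck_at_near_eq k f g x :
  (\forall y \near x, f y = g y) -> Ck_at k f x -> Ck_at k g x.
Proof.
elim: k f g => [|k IH] f g fg /=.
  move=> cf; have := near_join fg; move: cf; apply: filterS2 => y cf fgy.
  exact: continuous_near_eq fgy cf.
move=> fk i; have [df Dk] := fk i; split.
  have := near_join fg; move: df; apply: filterS2 => y df fgy.
  exact: near_eq_derivable fgy df.
apply: IH Dk; have := near_join fg; apply: filterS => y fgy.
exact: near_eq_derive.
Qed.

Lemma smooth_at_near_eq f g x :
  (\forall y \near x, f y = g y) -> smooth_at f x -> smooth_at g x.
Proof. by move=> fg sf k; exact: Ck_at_near_eq fg (sf k). Qed.

Lemma smooth_at_partial f x i : smooth_at f x -> smooth_at ('D_(e_ i) f) x.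
Proof. by move=> sf k; have [] := sf k.+1 i. Qed.

Lemma smooth_at_near_continuous f x :
  smooth_at f x -> \forall y \near x, {for y, continuous f}.
Proof. by move=> /(_ 0). Qed.

Lemma smooth_at_continuous f x : smooth_at f x -> {for x, continuous f}.
Proof. by move=> /smooth_at_near_continuous /nbhs_singleton. Qed.

Lemma smooth_at_near_derivable f x i :
  smooth_at f x -> \forall y \near x, derivable f y (e_ i).
Proof. by move=> /(_ 1) /(_ i) []. Qed.

Lemma C1_at_near_diff f x : Ck_at 1 f x ->
  \forall y \near x, differentiable f y /\ 'd f y = grad f y :> (_ -> _).
Proof.
move=> /= fC.
have D i : \forall z \near x, (\forall y \near z, derivable f y (e_ i)) /\
     {for z, continuous ('D_(e_ i) f)}.
  by have [df cf] := fC i; exact: filterI (near_join df) cf.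
apply: filterS (filter_forall _ D) => y Dy.
by apply: C1_diff => i; have [] := Dy i.
Qed.

(** [Ck_at] asks continuity of the derivatives of top order only; that of the lower ones follows
    from differentiability, hence from [C1_diff]. *)
Lemma Ck_atW k f x : Ck_at k.+1 f x -> Ck_at k f x.
Proof.
elim: k f => [|k IH] f.
  move=> /C1_at_near_diff; apply: filterS => y [df _].
  exact: differentiable_continuous.
by move=> fk i; have [df /IH] := fk i.
Qed.

Lemma smooth_at_near_diff f x : smooth_at f x ->
  \forall y \near x, differentiable f y /\ 'd f y = grad f y :> (_ -> _).
Proof. by move=> /(_ 1); exact: C1_at_near_diff. Qed.

Lemma smooth_at_diff f x : smooth_at f x ->
  differentiable f x /\ 'd f x = grad f x :> (_ -> _).
Proof. by move=> /smooth_at_near_diff /nbhs_singleton. Qed.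

Lemma smooth_at_derivable f x v : smooth_at f x -> derivable f x v.
Proof. by move=> /smooth_at_diff [df _]; exact: diff_derivable. Qed.

Lemma smooth_at_derive f x v : smooth_at f x -> 'D_v f x = grad f x v.
Proof. by move=> /smooth_at_diff [df <-]; exact: deriveE. Qed.

Lemma near_all (P : 'rV[R]_n -> Prop) x : (forall y, P y) -> \forall y \near x, P y.
Proof. by move=> allP; near=> y. Unshelve. all: by end_near. Qed.

Lemma smooth_at_cst (c : R) x : smooth_at (cst c) x.
Proof.
move=> k; elim: k c => [|k IH] c.
  by apply: near_all => y; exact: cst_continuous.
move=> i; split; first by apply: near_all => y; exact: derivable_cst.
by rewrite (_ : 'D_(e_ i) (cst c) = cst 0) //; apply/funext => y; rewrite derive_cst.
Qed.

Lemma is_derive_coord (j : 'I_n) x v :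
  is_derive x v (fun y : 'rV[R]_n => y 0 j) (v 0 j).
Proof.
apply: DeriveDef; first exact/diff_derivable/differentiable_coord.
rewrite deriveE; last exact: differentiable_coord.
pose f y : R := (y : 'rV[R]_n) 0 j.
have lf : linear f by move=> a u w; rewrite /f !mxE.
pose lF := GRing.isLinear.Build R 'rV[R]_n R *:%R f lf.
pose F : {linear 'rV[R]_n -> R} := HB.pack f lF.
rewrite (_ : (fun y : 'rV[R]_n => y 0 j) = F) // diff_lin //.
exact: coord_continuous.
Qed.

Lemma smooth_at_coord (j : 'I_n) x : smooth_at (fun y => y 0 j) x.
Proof.
case=> [|k]; first by apply: near_all => y; exact: coord_continuous.
move=> i; split; first by apply: near_all => y; have [] := is_derive_coord j y (e_ i).
rewrite (_ : 'D_(e_ i) _ = cst ((e_ i) 0 j)); first exact: smooth_at_cst.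
by apply/funext => y; have [_] := is_derive_coord j y (e_ i).
Qed.

Lemma Ck_atD k f g x :
  Ck_at k f x -> Ck_at k g x -> Ck_at k (fun y => f y + g y) x.
Proof.
elim: k f g => [|k IH] f g /=.
  by apply: filterS2 => y; exact: continuousD.
move=> fk gk i; have [[df fi] [dg gi]] := (fk i, gk i); split.
  by move: df dg; apply: filterS2 => y; exact: derivableD.
apply: Ck_at_near_eq (IH _ _ fi gi).
move: df dg; apply: filterS2 => y dfy dgy.
by rewrite -[fun y => f y + g y]/(f + g) deriveD.
Qed.

Lemma smooth_atD f g x :
  smooth_at f x -> smooth_at g x -> smooth_at (fun y => f y + g y) x.
Proof. by move=> sf sg k; exact: Ck_atD. Qed.

Lemma Ck_at_sum k (I : Type) (r : seq I) (F : I -> 'rV[R]_n -> R) x :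
  (forall i, Ck_at k (F i) x) -> Ck_at k (fun y => \sum_(i <- r) F i y) x.
Proof.
move=> sF; elim: r => [|i r IH].
  rewrite (_ : (fun _ => _) = cst 0); first exact: smooth_at_cst.
  by apply/funext => y; rewrite big_nil.
rewrite (_ : (fun _ => _) = fun y => F i y + \sum_(j <- r) F j y).
  exact: Ck_atD.
by apply/funext => y; rewrite big_cons.
Qed.

Lemma smooth_at_sum (I : Type) (r : seq I) (F : I -> 'rV[R]_n -> R) x :
  (forall i, smooth_at (F i) x) -> smooth_at (fun y => \sum_(i <- r) F i y) x.
Proof. by move=> sF k; apply: Ck_at_sum => i; exact: sF. Qed.

Lemma Ck_atM k f g x :
  Ck_at k f x -> Ck_at k g x -> Ck_at k (fun y => f y * g y) x.
Proof.
elim: k f g => [|k IH] f g.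
  by apply: filterS2 => y; exact: continuousM.
move=> fk gk i; have [[df fi] [dg gi]] := (fk i, gk i); split.
  by move: df dg; apply: filterS2 => y; exact: derivableM.
apply: Ck_at_near_eq (Ck_atD (IH _ _ (Ck_atW fk) gi) (IH _ _ (Ck_atW gk) fi)).
move: df dg; apply: filterS2 => y dfy dgy.
exact: esym (deriveM dfy dgy).
Qed.

Lemma smooth_atM f g x :
  smooth_at f x -> smooth_at g x -> smooth_at (fun y => f y * g y) x.
Proof. by move=> sf sg k; exact: Ck_atM. Qed.

Lemma smooth_atZ (a : R) f x : smooth_at f x -> smooth_at (fun y => a * f y) x.
Proof. by move=> sf; apply: smooth_atM sf; exact: smooth_at_cst. Qed.

Lemma smooth_atN f x : smooth_at f x -> smooth_at (fun y => - f y) x.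
Proof.
move=> /(smooth_atZ (-1)); rewrite (_ : (fun _ => _) = fun y => - f y) //.
by apply/funext => y; rewrite mulN1r.
Qed.

Lemma smooth_atB f g x :
  smooth_at f x -> smooth_at g x -> smooth_at (fun y => f y - g y) x.
Proof. by move=> sf sg; apply: smooth_atD sf _; exact: smooth_atN. Qed.

Lemma smooth_at_schwarz f x i j : smooth_at f x ->
  'D_(e_ i) ('D_(e_ j) f) x = 'D_(e_ j) ('D_(e_ i) f) x.
Proof.
move=> sf.
have D k l : \forall y \near x,
    derivable f y (e_ k) /\ derivable ('D_(e_ k) f) y (e_ l).
  apply: filterI; first exact: smooth_at_near_derivable.
  exact/smooth_at_near_derivable/smooth_at_partial.
have C k l : {for x, continuous ('D_(e_ l) ('D_(e_ k) f))}.
  by apply: smooth_at_continuous; do 2 apply: smooth_at_partial.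
exact: (schwarz (D j i) (D i j) (C j i) (C i j)).
Qed.

End SmoothAt.

(** * Chain rule and composition of smooth maps *)

Section Composition.
Context {R : realType} {n m : nat}.
Implicit Types (f : 'rV[R]_m -> R) (T : 'rV[R]_n -> 'rV[R]_m) (x y : 'rV[R]_n).

Local Notation e_ i := (delta_mx 0 i : 'rV[R]_(_)).

Definition smooth_map_at T x := forall j, smooth_at (fun y => T y 0 j) x.

Lemma smooth_map_near_diff T x : smooth_map_at T x ->
  \forall y \near x, differentiable T y.
Proof.
move=> sT; have D := fun j => smooth_at_near_diff (sT j).
apply: filterS (filter_forall _ D) => y Ty.
rewrite (_ : T = \sum_(j < m) (fun y => T y 0 j *: delta_mx 0 j)).
  by apply: differentiable_sum => j; apply: differentiableZl; have [] := Ty j.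
apply/funext => z; rewrite fct_sumE; exact: row_sum_delta.
Qed.

Lemma smooth_map_diff T x : smooth_map_at T x -> differentiable T x.
Proof. by move=> /smooth_map_near_diff /nbhs_singleton. Qed.

Lemma smooth_map_continuous T x : smooth_map_at T x -> {for x, continuous T}.
Proof. by move=> /smooth_map_diff /differentiable_continuous. Qed.

Lemma derive_coord T x v j : differentiable T x ->
  ('D_v T x) 0 j = 'D_v (fun y => T y 0 j) x.
Proof. by move=> /diff_derivable dT; rewrite derive_mx // mxE. Qed.

Lemma smooth_map_jacobian T x i j : smooth_map_at T x ->
  ('J T x) i j = 'D_(e_ i) (fun y => T y 0 j) x.
Proof.
move=> /smooth_map_diff dT; rewrite -derive_coord // deriveEjacobian //.
by rewrite -rowE [RHS]mxE.
Qed.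

Lemma derive_comp_grad f T x v :
  differentiable f (T x) /\ 'd f (T x) = grad f (T x) :> (_ -> _) ->
  differentiable T x ->
  'D_v (f \o T) x = \sum_j 'D_v (fun y => T y 0 j) x * 'D_(e_ j) f (T x).
Proof.
move=> [df gf] dT; rewrite deriveE; last exact: differentiable_comp.
rewrite diff_comp //= gf -deriveE //; apply: eq_bigr => j _.
by rewrite derive_coord.
Qed.

Lemma derive_comp f T x v : smooth_at f (T x) -> smooth_map_at T x ->
  'D_v (f \o T) x = \sum_j 'D_v (fun y => T y 0 j) x * 'D_(e_ j) f (T x).
Proof.
by move=> /smooth_at_diff df /smooth_map_diff dT; exact: derive_comp_grad.
Qed.

(** Induction on the order with [f] general: by the chain rule a partial derivative of [f \o T] is a
    sum of products of a partial derivative of [T] and some ['D_(e_ j) f \o T], to which the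
    induction hypothesis applies. *)
Lemma smooth_at_comp f T x : smooth_at f (T x) -> smooth_map_at T x ->
  smooth_at (f \o T) x.
Proof.
move=> + sT k; elim: k f => [|k IH] f sf.
  have cf : \forall y \near x, {for T y, continuous f}.
    exact: near_comp (smooth_map_continuous sT) (smooth_at_near_continuous sf).
  move: cf (smooth_map_near_diff sT); apply: filterS2 => y cf dT.
  by apply: continuous_comp cf; exact: differentiable_continuous.
have sTn : \forall y \near x, (differentiable f (T y) /\ 'd f (T y) = grad f (T y) :> (_ -> _))
    /\ differentiable T y.
  apply: filterI; last exact: smooth_map_near_diff.
  exact: near_comp (smooth_map_continuous sT) (smooth_at_near_diff sf).
move=> i; split.
  apply: filterS sTn => y [[df _] dT]; apply: diff_derivable.
  exact: differentiable_comp.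
have E : \forall y \near x,
    \sum_j 'D_(e_ i) (fun z => T z 0 j) y * ('D_(e_ j) f \o T) y =
    'D_(e_ i) (f \o T) y.
  by apply: filterS sTn => y [df dT]; rewrite derive_comp_grad.
apply: Ck_at_near_eq E _; apply: Ck_at_sum => j; apply: Ck_atM.
  exact: smooth_at_partial (sT j) k.
by apply: IH; exact: smooth_at_partial.
Qed.

End Composition.

(** * A smooth function vanishing exactly on the nonpositive reals *)

Section Flat.
Context {R : realType}.
Implicit Types (m : nat) (t : R).

(** The exponent [m] closes the family under differentiation: on positive reals the derivative of
    [t^-m exp(-1/t)] is [t^-(m+2) exp(-1/t) - m t^-(m+1) exp(-1/t)]. Smoothness is thus proved for
    all [m] together, although the bump function takes [m = 0]. *)
Definition flat m t : R := if 0 < t then t^-1 ^+ m * expR (- t^-1) else 0.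

Lemma flat_gt0 m t : 0 < t -> 0 < flat m t.
Proof. by move=> t0; rewrite /flat t0 mulr_gt0 ?expR_gt0 // exprn_gt0 ?invr_gt0. Qed.

Lemma flat_le0 m t : t <= 0 -> flat m t = 0.
Proof. by move=> t0; rewrite /flat ltNge t0. Qed.

(** The exponential series gives [exp(1/t) >= t^-(m+2) / (m+2)!]. Two powers more than [m] leave a
    quadratic bound, which makes the difference quotient at [0] tend to [0]. *)
Lemma flat_sqr_bound m t : `|flat m t| <= (m.+2)`!%:R * t ^+ 2.
Proof.
have [t0|t0] := leP t 0.
  by rewrite flat_le0 // normr0 mulr_ge0 // ?ler0n // sqr_ge0.
rewrite ger0_norm ?(ltW (flat_gt0 _ _)) // /flat t0 expRN.
set F : R := (m.+2)`!%:R; have F0 : 0 < F by rewrite ltr0n fact_gt0.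
have u0 : 0 < t^-1 by rewrite invr_gt0.
rewrite ler_pdivrMr ?expR_gt0 //.
apply: (@le_trans _ _ (F * t ^+ 2 * (t^-1 ^+ m.+2 / F))); last first.
  apply: ler_wpM2l; first by rewrite mulr_ge0 ?sqr_ge0 ?(ltW F0).
  apply: le_trans (expR_ge1Dxn m.+1 (ltW u0)).
  by rewrite ler_wpDl.
rewrite -[m.+2]/(2 + m)%N exprD.
have -> : F * t ^+ 2 * (t^-1 ^+ 2 * t^-1 ^+ m / F) =
    t^-1 ^+ m * (t * t^-1) ^+ 2 * (F / F) by ring.
by rewrite !divff ?gt_eqF // expr1n !mulr1.
Qed.

Lemma is_derive_flat m t :
  is_derive t 1 (flat m) (flat m.+2 t - m%:R * flat m.+1 t).
Proof.
have [t0|t0|<-] := ltgtP 0 t.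
- have dV : is_derive t 1 (fun s : R => s^-1) (- t ^- 2 *: 1).
    exact: (is_deriveV (lt0r_neq0 t0) (is_derive_id t 1)).
  have dN : is_derive t^-1 1 (fun u : R => expR (- u)) (expR (- t^-1) * - 1).
    exact: is_derive1_comp.
  have dX := is_deriveX m (is_derive_id (t^-1) 1).
  have := is_derive1_comp (is_deriveM dX dN) dV.
  rewrite (_ : _ * _ = flat m.+2 t - m%:R * flat m.+1 t); last first.
    rewrite /flat t0 -![_ *: _]/(_ * _) /= -exprVn !exprfctE.
    case: (m) => [|k] /=; rewrite !exprS ?expr0; ring.
  apply: near_eq_is_derive; near=> s; rewrite /flat ifT //=.
    by rewrite mulrfctE exprfctE.
  near: s; apply: open_nbhs_nbhs; split; first exact: open_gt.
  exact: t0.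
- have -> : flat m.+2 t - m%:R * flat m.+1 t = 0.
    by rewrite !flat_le0 ?(ltW t0) // mulr0 subr0.
  apply: near_eq_is_derive (is_derive_cst 0 t 1); near=> s; rewrite flat_le0 //.
  apply/ltW; near: s; apply: open_nbhs_nbhs; split; first exact: open_lt.
  exact: t0.
- have -> : flat m.+2 0 - m%:R * flat m.+1 0 = 0.
    by rewrite !flat_le0 // mulr0 subr0.
  have C : (fun h : R => h^-1 *: ((flat m \o shift 0) (h *: 1) - flat m 0)) @ 0^' --> (0 : R).
    have F0 : 0 < (m.+2)`!%:R :> R by rewrite ltr0n fact_gt0.
    apply/cvgrPdist_le => e e0; near=> h.
    have h0 : h != 0 by near: h; exact: nbhs_dnbhs_neq.
    have he : `|h| <= e / (m.+2)`!%:R.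
      by apply/ltW; near: h; apply: dnbhs0_lt; rewrite divr_gt0.
    rewrite sub0r normrN /= addr0 [h *: 1]mulr1 (@flat_le0 m 0) // subr0.
    rewrite normrZ normfV ler_pdivrMl ?normr_gt0 //.
    apply: le_trans (flat_sqr_bound m h) _.
    rewrite -real_normK ?num_real // expr2 mulrA mulrC ler_wpM2l //.
    by rewrite mulrC -ler_pdivlMr.
  apply: DeriveDef; last exact: cvg_lim C.
  by apply/cvg_ex; exists 0.
Unshelve. all: by end_near. Qed.

Lemma differentiable_flat m t : differentiable (flat m) t.
Proof. by apply/derivable1_diffP; have [] := is_derive_flat m t. Qed.

Lemma smooth_at_flat n m (q : 'rV[R]_n -> R) x :
  smooth_at q x -> smooth_at (flat m \o q) x.
Proof.
move=> sq k; elim: k m => [|k IH] m.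
  apply: filterS (smooth_at_near_continuous sq) => y cq.
  apply: continuous_comp cq _.
  exact/differentiable_continuous/differentiable_flat.
move=> i; split.
  apply: filterS (smooth_at_near_diff sq) => y [dq _].
  by apply/diff_derivable/differentiable_comp => //; exact: differentiable_flat.
have : Ck_at k (fun y => 'D_(delta_mx 0 i) q y *
    ((flat m.+2 \o q) y + - m%:R * (flat m.+1 \o q) y)) x.
  apply: Ck_atM; first exact: smooth_at_partial sq k.
  by apply: Ck_atD => //; apply: Ck_atM => //; exact: smooth_at_cst.
apply: Ck_at_near_eq; apply: filterS (smooth_at_near_diff sq) => y [dq _].
rewrite [RHS]deriveE; last exact: differentiable_comp (differentiable_flat _ _).
rewrite diff_comp //=; last exact: differentiable_flat.
rewrite -(deriveE _ dq) diff1E; last exact: differentiable_flat.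
rewrite derive1E; have [_ ->] := is_derive_flat m (q y).
by rewrite -[RHS]/(_ * _) mulNr.
Qed.

End Flat.

(** * Smooth functions and vector fields in charts *)

Section Charts.
Context {R : realType} {n : nat} {M : oriented_manifold R n}.
Implicit Types (a b c : chart R n M) (p q : M) (f : M -> R) (X Y : vfield M).

Local Notation e_ i := (delta_mx 0 i : 'rV[R]_n).

Lemma near_chart_dom c p : chart_dom c p -> \forall q \near p, chart_dom c q.
Proof. by move=> cp; apply: open_nbhs_nbhs; split=> //; exact: chart_dom_open. Qed.

Lemma near_chart_inv c p (P : M -> Prop) : chart_dom c p ->
  (\forall q \near p, P q) -> \forall y \near chart_map c p, P (chart_inv c y).
Proof.
move=> cp Pp; apply: near_comp; last by rewrite chart_mapK.
by apply: chart_inv_continuous; exists p.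
Qed.

(** Since the image of a chart is open, a property of coordinates near [chart_map c p] has to be
    checked only at coordinates of actual points. *)
Lemma near_chart c p (P : 'rV[R]_n -> Prop) : chart_dom c p ->
  (\forall q \near p, P (chart_map c q)) -> \forall y \near chart_map c p, P y.
Proof.
move=> cp Pp.
have img : \forall y \near chart_map c p, (chart_map c @` chart_dom c) y.
  by apply: open_nbhs_nbhs; split; [exact: chart_img_open|exists p].
move: img (near_chart_inv cp Pp); apply: filterS2 => y [q cq <-].
by rewrite chart_mapK.
Qed.

Lemma open_chart_inter a b :
  open (chart_map a @` (chart_dom a `&` chart_dom b)).
Proof.
rewrite openE => y [p [ap bp] <-]; apply: (near_chart ap).
by apply: filterS2 (near_chart_dom ap) (near_chart_dom bp) => q aq bq; exists q.
Qed.

Lemma transition_smooth_at a b p : atlas a -> atlas b ->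
  chart_dom a p -> chart_dom b p ->
  smooth_map_at (transition a b) (chart_map a p).
Proof.
move=> aA bA ap bp j; have := transition_smooth aA bA j.
by move/smooth_onP => /(_ (@open_chart_inter a b)); apply; exists p.
Qed.

Lemma transitionE a b p : chart_dom a p -> transition a b (chart_map a p) = chart_map b p.
Proof. by move=> ap; rewrite /transition /= chart_mapK. Qed.

Lemma transition_jacE a b p i j : atlas a -> atlas b ->
  chart_dom a p -> chart_dom b p ->
  transition_jac a b p i j =
    'D_(e_ i) (fun y => transition a b y 0 j) (chart_map a p).
Proof. by move=> aA bA ap bp; exact/smooth_map_jacobian/transition_smooth_at. Qed.

Lemma derive_transition a b p v j : atlas a -> atlas b ->
  chart_dom a p -> chart_dom b p ->
  'D_v (fun y => transition a b y 0 j) (chart_map a p) =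
    (v *m transition_jac a b p) 0 j.
Proof.
move=> aA bA ap bp.
have dT := smooth_map_diff (transition_smooth_at aA bA ap bp).
by rewrite -derive_coord // deriveEjacobian.
Qed.

(** The chain rule for [transition a c], which near the point factors through [b]; as tangent
    vectors are rows, the first change of chart stands on the left. *)
Lemma transition_jac_comp a b c p : atlas a -> atlas b -> atlas c ->
  chart_dom a p -> chart_dom b p -> chart_dom c p ->
  transition_jac a c p = transition_jac a b p *m transition_jac b c p.
Proof.
move=> aA bA cA ap bp cp; apply/matrixP => i j; rewrite [RHS]mxE.
apply: etrans (transition_jacE i j aA cA ap cp) _.
have E : \forall y \near chart_map a p, transition a c y 0 j =
    ((fun z => transition b c z 0 j) \o transition a b) y.
  apply: (near_chart ap); apply: filterS2 (near_chart_dom ap) (near_chart_dom bp).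
  by move=> q aq bq; rewrite /= !transitionE.
rewrite (near_eq_derive _ E) derive_comp; last exact: transition_smooth_at.
  apply: eq_bigr => k _; rewrite (transitionE _ ap).
  by congr (_ * _); apply/esym; exact: transition_jacE.
by rewrite (transitionE _ ap); exact: transition_smooth_at.
Qed.

Lemma transition_jacxx a p : atlas a -> chart_dom a p -> transition_jac a a p = 1%:M.
Proof.
move=> aA ap; apply/matrixP => i j.
apply: etrans (transition_jacE i j aA aA ap ap) _.
have E : \forall y \near chart_map a p, transition a a y 0 j = y 0 j.
  apply: (near_chart ap); apply: filterS (near_chart_dom ap) => q aq.
  by rewrite transitionE.
rewrite (near_eq_derive _ E).
by have [_ ->] := is_derive_coord j (chart_map a p) (e_ i); rewrite !mxE eqxx eq_sym.
Qed.

Lemma transition_jacK a b p : atlas a -> atlas b ->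
  chart_dom a p -> chart_dom b p ->
  transition_jac a b p *m transition_jac b a p = 1%:M.
Proof. by move=> aA bA ap bp; rewrite -transition_jac_comp // transition_jacxx. Qed.

Lemma smooth_chart_change a b p f : atlas a -> atlas b ->
  chart_dom a p -> chart_dom b p ->
  smooth_at (f \o chart_inv a) (chart_map a p) ->
  smooth_at (f \o chart_inv b) (chart_map b p).
Proof.
move=> aA bA ap bp sf.
have : smooth_at ((f \o chart_inv a) \o transition b a) (chart_map b p).
  by apply: smooth_at_comp; rewrite ?transitionE //; exact: transition_smooth_at.
apply: smooth_at_near_eq; apply: (near_chart bp).
apply: filterS2 (near_chart_dom ap) (near_chart_dom bp) => q aq bq.
by rewrite /= transitionE // !chart_mapK.
Qed.

Definition smooth_fun_at f p :=
  forall c, atlas c -> chart_dom c p -> smooth_at (f \o chart_inv c) (chart_map c p).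

Lemma smooth_fun_at_chart c f p : atlas c -> chart_dom c p ->
  smooth_at (f \o chart_inv c) (chart_map c p) -> smooth_fun_at f p.
Proof. by move=> cA cp sf b bA bp; exact: smooth_chart_change cA bA cp bp sf. Qed.

Lemma smooth_funP f : smooth_fun f <-> forall p, smooth_fun_at f p.
Proof.
split=> [sf p c cA cp|sf c cA].
  by have /smooth_onP := sf c cA; apply; [exact: chart_img_open|exists p].
by apply/smooth_onP; [exact: chart_img_open|move=> y [p cp <-]; exact: sf].
Qed.

Lemma smooth_fun_at_near_eq f f' p : (\forall q \near p, f q = f' q) ->
  smooth_fun_at f p -> smooth_fun_at f' p.
Proof.
move=> ff' sf c cA cp; apply: smooth_at_near_eq (sf c cA cp).
exact: near_chart_inv ff'.
Qed.

Lemma smooth_fun_at_cst (k : R) p : smooth_fun_at (fun=> k) p.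
Proof. by move=> c cA cp; exact: smooth_at_cst. Qed.

Lemma smooth_fun_atD f f' p :
  smooth_fun_at f p -> smooth_fun_at f' p -> smooth_fun_at (fun q => f q + f' q) p.
Proof. by move=> sf sf' c cA cp; apply: smooth_atD; [exact: sf|exact: sf']. Qed.

Lemma smooth_fun_atM f f' p :
  smooth_fun_at f p -> smooth_fun_at f' p -> smooth_fun_at (fun q => f q * f' q) p.
Proof. by move=> sf sf' c cA cp; apply: smooth_atM; [exact: sf|exact: sf']. Qed.

Lemma smooth_fun_at_sum (I : Type) (r : seq I) (F : I -> M -> R) p :
  (forall i, smooth_fun_at (F i) p) -> smooth_fun_at (fun q => \sum_(i <- r) F i q) p.
Proof. by move=> sF c cA cp; apply: smooth_at_sum => i; exact: sF. Qed.

Lemma smooth_fun_at_chart_map c p i : atlas c -> chart_dom c p ->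
  smooth_fun_at (fun q => chart_map c q 0 i) p.
Proof.
move=> cA cp; apply: (smooth_fun_at_chart cA cp).
apply: smooth_at_near_eq (smooth_at_coord i _); apply: (near_chart cp).
by apply: filterS (near_chart_dom cp) => q cq; rewrite /= chart_mapK.
Qed.

Lemma smooth_fun_at_comp_chart c p F : atlas c -> chart_dom c p ->
  smooth_at F (chart_map c p) -> smooth_fun_at (F \o chart_map c) p.
Proof.
move=> cA cp sF; apply: (smooth_fun_at_chart cA cp).
apply: smooth_at_near_eq sF; apply: (near_chart cp).
by apply: filterS (near_chart_dom cp) => q cq; rewrite /= chart_mapK.
Qed.

Lemma smooth_fun_at_jac a b p i j : atlas a -> atlas b ->
  chart_dom a p -> chart_dom b p ->
  smooth_fun_at (fun q => transition_jac a b q i j) p.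
Proof.
move=> aA bA ap bp.
have : smooth_fun_at ('D_(e_ i) (fun y => transition a b y 0 j) \o chart_map a) p.
  apply: smooth_fun_at_comp_chart => //.
  exact/smooth_at_partial/transition_smooth_at.
apply: smooth_fun_at_near_eq.
apply: filterS2 (near_chart_dom ap) (near_chart_dom bp) => q aq bq.
exact: esym (transition_jacE i j aA bA aq bq).
Qed.

(** The row [X q] refers to the chart [chart_at q], which may jump with [q]. Only after passing to
    one fixed chart do the entries become functions whose smoothness is meaningful. *)
Definition comp_in c X q : 'rV[R]_n := X q *m transition_jac (chart_at q) c q.

Lemma in_chartE c X q : chart_dom c q -> in_chart c X (chart_map c q) = comp_in c X q.
Proof. by move=> cq; rewrite /in_chart /= chart_mapK. Qed.

Lemma comp_in_chart_at X p : comp_in (chart_at p) X p = X p.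
Proof.
by rewrite /comp_in transition_jacxx ?mulmx1 //; [exact: chart_at_atlas|exact: chart_at_dom].
Qed.

Lemma comp_in_change a b X q : atlas a -> atlas b -> chart_dom a q -> chart_dom b q ->
  comp_in b X q = comp_in a X q *m transition_jac a b q.
Proof.
move=> aA bA aq bq; rewrite /comp_in -mulmxA -transition_jac_comp //.
  exact: chart_at_atlas.
exact: chart_at_dom.
Qed.

Lemma comp_in_coord_vector c X q : atlas c -> chart_dom c q ->
  X q = \sum_i comp_in c X q 0 i *: coord_vector c q i.
Proof.
move=> cA cq.
have -> : X q = comp_in c X q *m transition_jac c (chart_at q) q.
  by rewrite -comp_in_change ?comp_in_chart_at //; [exact: chart_at_atlas|exact: chart_at_dom].
rewrite [in LHS](row_sum_delta (comp_in c X q)) mulmx_suml.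
by apply: eq_bigr => i _; rewrite -scalemxAl.
Qed.

Definition smooth_vfield_at X p := forall c, atlas c -> chart_dom c p ->
  forall i, smooth_fun_at (fun q => comp_in c X q 0 i) p.

Lemma smooth_vfield_at_chart c X p : atlas c -> chart_dom c p ->
  (forall i, smooth_fun_at (fun q => comp_in c X q 0 i) p) -> smooth_vfield_at X p.
Proof.
move=> cA cp sX b bA bp i.
have : smooth_fun_at (fun q => \sum_k comp_in c X q 0 k * transition_jac c b q k i) p.
  by apply: smooth_fun_at_sum => k; apply: smooth_fun_atM => //; exact: smooth_fun_at_jac.
apply: smooth_fun_at_near_eq.
apply: filterS2 (near_chart_dom bp) (near_chart_dom cp) => q bq cq.
by rewrite (comp_in_change X cA bA cq bq) [RHS]mxE.
Qed.

Lemma smooth_vfieldP X : smooth_vfield X <-> forall p, smooth_vfield_at X p.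
Proof.
have E c p i : chart_dom c p -> \forall y \near chart_map c p,
   in_chart c X y 0 i = ((fun q => comp_in c X q 0 i) \o chart_inv c) y.
  move=> cp; apply: (near_chart cp); apply: filterS (near_chart_dom cp) => q cq.
  rewrite (in_chartE X cq).
  by rewrite -[RHS]/(comp_in c X (chart_inv c (chart_map c q)) 0 i) (chart_mapK cq).
split=> [sX p c cA cp i|sX c cA i].
  apply: (smooth_fun_at_chart cA cp).
  apply: smooth_at_near_eq (E c p i cp) _.
  have /smooth_onP := sX c cA i; apply; [exact: chart_img_open|by exists p].
apply/smooth_onP; first exact: chart_img_open.
move=> y [p cp <-]; apply: smooth_at_near_eq (sX p c cA cp i c cA cp).
by apply: filterS (E c p i cp) => z; exact: esym.
Qed.

Lemma smooth_vfield_at_near_eq X Y p : (\forall q \near p, X q = Y q) ->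
  smooth_vfield_at X p -> smooth_vfield_at Y p.
Proof.
move=> XY sX c cA cp i; apply: smooth_fun_at_near_eq (sX c cA cp i).
by apply: filterS XY => q; rewrite /comp_in => ->.
Qed.

Lemma smooth_vfield_atD X Y p : smooth_vfield_at X p -> smooth_vfield_at Y p ->
  smooth_vfield_at (fun q => X q + Y q) p.
Proof.
move=> sX sY c cA cp i.
rewrite (_ : (fun _ => _) = fun q => comp_in c X q 0 i + comp_in c Y q 0 i).
  by apply: smooth_fun_atD; [exact: sX|exact: sY].
by apply/funext => q; rewrite /comp_in mulmxDl mxE.
Qed.

Lemma smooth_vfield_atZ f X p : smooth_fun_at f p -> smooth_vfield_at X p ->
  smooth_vfield_at (fun q => f q *: X q) p.
Proof.
move=> sf sX c cA cp i.
rewrite (_ : (fun _ => _) = fun q => f q * comp_in c X q 0 i).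
  by apply: smooth_fun_atM => //; exact: sX.
by apply/funext => q; rewrite /comp_in -scalemxAl mxE.
Qed.

Lemma smooth_vfield_at0 p : smooth_vfield_at (fun=> 0) p.
Proof.
move=> c cA cp i; rewrite (_ : (fun _ => _) = fun=> 0); first exact: smooth_fun_at_cst.
by apply/funext => q; rewrite /comp_in mul0mx mxE.
Qed.

Lemma smooth_vfield_at_coord c p i : atlas c -> chart_dom c p ->
  smooth_vfield_at (fun q => coord_vector c q i) p.
Proof.
move=> cA cp; apply: (smooth_vfield_at_chart cA cp) => j.
apply: (@smooth_fun_at_near_eq (fun=> (e_ i) 0 j) _ p); last exact: smooth_fun_at_cst.
apply: filterS (near_chart_dom cp) => q cq.
rewrite /comp_in /coord_vector -mulmxA transition_jacK ?mulmx1 //.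
  exact: chart_at_atlas.
exact: chart_at_dom.
Qed.

Lemma coord_vector_chart_at p i : coord_vector (chart_at p) p i = e_ i.
Proof.
rewrite /coord_vector transition_jacxx ?mulmx1 //.
  exact: chart_at_atlas.
exact: chart_at_dom.
Qed.

End Charts.

(** * Directional derivatives and the Lie bracket *)

Section Fields.
Context {R : realType} {n : nat} {M : oriented_manifold R n}.
Implicit Types (a b c : chart R n M) (p q : M) (f : M -> R) (X Y : vfield M).

Local Notation e_ i := (delta_mx 0 i : 'rV[R]_n).

Lemma inner_suml (g : metric M) p (I : Type) (r : seq I) (k : I -> R)
    (v : I -> 'rV[R]_n) w :
  g p (\sum_(i <- r) k i *: v i) w = \sum_(i <- r) k i * g p (v i) w.
Proof.
elim: r => [|i r IH]; last by rewrite !big_cons inner_linear IH.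
rewrite !big_nil; have := inner_linear g p (-1) 0 0 w.
by rewrite scaler0 addr0 mulN1r addNr.
Qed.

Lemma inner_sumr (g : metric M) p (I : Type) (r : seq I) (k : I -> R)
    (v : I -> 'rV[R]_n) w :
  g p w (\sum_(i <- r) k i *: v i) = \sum_(i <- r) k i * g p w (v i).
Proof. by rewrite innerC inner_suml; apply: eq_bigr => i _; rewrite innerC. Qed.

Lemma smooth_inner (g : metric M) X Y p :
  smooth_vfield_at X p -> smooth_vfield_at Y p ->
  smooth_fun_at (fun q => g q (X q) (Y q)) p.
Proof.
move=> sX sY; have cA := chart_at_atlas p; have cp := chart_at_dom p.
set c := chart_at p in cA cp.
have : smooth_fun_at (fun q => \sum_i \sum_j
   comp_in c X q 0 i * (comp_in c Y q 0 j * g q (coord_vector c q i) (coord_vector c q j))) p.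
  apply: smooth_fun_at_sum => i; apply: smooth_fun_at_sum => j.
  apply: smooth_fun_atM; first exact: sX.
  apply: smooth_fun_atM; first exact: sY.
  apply: (smooth_fun_at_chart cA cp).
  have /smooth_onP := inner_smooth g cA i j; apply; first exact: chart_img_open.
  by exists p.
apply: smooth_fun_at_near_eq; apply: filterS (near_chart_dom cp) => q cq.
rewrite [in RHS](comp_in_coord_vector X cA cq) [in RHS](comp_in_coord_vector Y cA cq).
rewrite inner_suml; apply: eq_bigr => i _; rewrite inner_sumr mulr_sumr.
exact: eq_bigr.
Qed.

Lemma dir_derivE c X f p : atlas c -> chart_dom c p -> smooth_fun_at f p ->
  dir_deriv X f p =
    \sum_i comp_in c X p 0 i * 'D_(e_ i) (f \o chart_inv c) (chart_map c p).
Proof.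
move=> cA cp sf; have aA := chart_at_atlas p; have ap := chart_at_dom p.
rewrite /dir_deriv; set a := chart_at p in aA ap *.
have E : \forall y \near chart_map a p, (f \o chart_inv a) y =
    ((f \o chart_inv c) \o transition a c) y.
  apply: (near_chart ap); apply: filterS2 (near_chart_dom ap) (near_chart_dom cp).
  by move=> q aq cq; rewrite /= transitionE // !chart_mapK.
rewrite (near_eq_derive _ E) derive_comp; last exact: transition_smooth_at.
  apply: eq_bigr => i _; rewrite (transitionE _ ap); congr (_ * _).
  exact: derive_transition.
by rewrite (transitionE _ ap); exact: sf.
Qed.

Lemma dir_deriv_grad X f p : smooth_fun_at f p ->
  dir_deriv X f p =
    grad (f \o chart_inv (chart_at p)) (chart_map (chart_at p) p) (X p).
Proof.
move=> sf; rewrite /dir_deriv; apply: smooth_at_derive; apply: sf.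
  exact: chart_at_atlas.
exact: chart_at_dom.
Qed.

Lemma smooth_dir_deriv X f p : smooth_vfield_at X p -> (forall q, smooth_fun_at f q) ->
  smooth_fun_at (dir_deriv X f) p.
Proof.
move=> sX sf; have cA := chart_at_atlas p; have cp := chart_at_dom p.
set c := chart_at p in cA cp.
have : smooth_fun_at (fun q => \sum_i comp_in c X q 0 i *
    ('D_(e_ i) (f \o chart_inv c) \o chart_map c) q) p.
  apply: smooth_fun_at_sum => i; apply: smooth_fun_atM; first exact: sX.
  apply: smooth_fun_at_comp_chart => //.
  by apply: smooth_at_partial; apply: sf.
apply: smooth_fun_at_near_eq; apply: filterS (near_chart_dom cp) => q cq.
apply: esym; exact: dir_derivE.
Qed.

Lemma dir_derivD X f f' p : smooth_fun_at f p -> smooth_fun_at f' p ->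
  dir_deriv X (fun q => f q + f' q) p = dir_deriv X f p + dir_deriv X f' p.
Proof.
move=> sf sf'; have aA := chart_at_atlas p; have ap := chart_at_dom p.
rewrite /dir_deriv; set c := chart_at p in aA ap *.
rewrite (_ : _ \o chart_inv c = (f \o chart_inv c) + (f' \o chart_inv c)); last exact: funext.
apply: deriveD; apply: smooth_at_derivable; [exact: sf|exact: sf'].
Qed.

Lemma dir_derivM X f f' p : smooth_fun_at f p -> smooth_fun_at f' p ->
  dir_deriv X (fun q => f q * f' q) p = f p * dir_deriv X f' p + f' p * dir_deriv X f p.
Proof.
move=> sf sf'; have aA := chart_at_atlas p; have ap := chart_at_dom p.
rewrite /dir_deriv; set c := chart_at p in aA ap *.
rewrite (_ : _ \o chart_inv c = (f \o chart_inv c) * (f' \o chart_inv c)); last exact: funext.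
rewrite deriveM /= ?(chart_mapK ap) //; apply: smooth_at_derivable; [exact: sf|exact: sf'].
Qed.

Lemma dir_deriv_lin (k : R) X Y Z f p : smooth_fun_at f p -> Z p = k *: X p + Y p ->
  dir_deriv Z f p = k * dir_deriv X f p + dir_deriv Y f p.
Proof. by move=> sf Zp; rewrite !dir_deriv_grad // Zp linearP. Qed.

Lemma lie_bracket_dir_deriv X Y f p :
  (forall q, smooth_vfield_at X q) -> (forall q, smooth_vfield_at Y q) ->
  (forall q, smooth_fun_at f q) ->
  dir_deriv (lie_bracket X Y) f p =
    dir_deriv X (dir_deriv Y f) p - dir_deriv Y (dir_deriv X f) p.
Proof.
move=> sX sY sf; have cA := chart_at_atlas p; have cp := chart_at_dom p.
set c := chart_at p in cA cp; set x := chart_map c p.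
pose F := f \o chart_inv c.
have sF : smooth_at F x by exact: sf.
have sC Z i : (forall q, smooth_vfield_at Z q) -> smooth_at (fun y => in_chart c Z y 0 i) x.
  move=> sZ; have /smooth_vfieldP/(_ c cA i) /smooth_onP := sZ.
  by apply; [exact: chart_img_open|exists p].
(* The product rule separates a second-order part, with the components of [W] frozen at [p], from a
   first-order part where those components are differentiated. The former cancels under
   antisymmetrization by Schwarz's theorem; the latter forms the bracket. *)
have iter Z W : (forall q, smooth_vfield_at Z q) -> (forall q, smooth_vfield_at W q) ->
  dir_deriv Z (dir_deriv W f) p =
   \sum_i (W p 0 i * (\sum_j Z p 0 j * 'D_(e_ j) ('D_(e_ i) F) x) +
     'D_(e_ i) F x * 'D_(Z p) (fun y => in_chart c W y 0 i) x).
  move=> sZ sW; rewrite /dir_deriv -/c -/x.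
  have E : \forall y \near x, (dir_deriv W f \o chart_inv c) y =
     (\sum_i (fun y => in_chart c W y 0 i * 'D_(e_ i) F y)) y.
    apply: (near_chart cp); apply: filterS (near_chart_dom cp) => q cq.
    rewrite fct_sumE -[LHS]/(dir_deriv W f (chart_inv c (chart_map c q))) (chart_mapK cq).
    apply: etrans (dir_derivE W cA cq (sf q)) _.
    apply: eq_bigr => i _.
    rewrite -[RHS]/(in_chart c W (chart_map c q) 0 i * 'D_(e_ i) F (chart_map c q)).
    by rewrite (in_chartE W cq).
  rewrite (near_eq_derive _ E) derive_sum; last first.
    move=> i; apply: smooth_at_derivable; apply: smooth_atM; first exact: sC.
    exact: smooth_at_partial.
  apply: eq_bigr => i _.
  have dW : derivable (fun y => in_chart c W y 0 i) x (Z p).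
    exact: smooth_at_derivable (sC W i sW).
  have dF : derivable ('D_(e_ i) F) x (Z p).
    exact: smooth_at_derivable (smooth_at_partial i sF).
  apply: etrans (deriveM dW dF) _.
  rewrite (in_chartE W cp) comp_in_chart_at.
  by rewrite [X in _ *: X + _](smooth_at_derive _ (smooth_at_partial i sF)).
rewrite (iter X Y sX sY) (iter Y X sY sX) -sumrB.
rewrite dir_deriv_grad // -/c -/x -/F /grad.
have dC Z : (forall q, smooth_vfield_at Z q) -> differentiable (in_chart c Z) x.
  by move=> sZ; apply: smooth_map_diff => i; exact: sC.
have split_i (i : 'I_n) : lie_bracket X Y p 0 i =
    'D_(X p) (fun y => in_chart c Y y 0 i) x - 'D_(Y p) (fun y => in_chart c X y 0 i) x.
  rewrite /lie_bracket -/c -/x [LHS]mxE [X in _ + X]mxE.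
  by rewrite (derive_coord _ _ (dC Y sY)) (derive_coord _ _ (dC X sX)).
under eq_bigr => i _ do rewrite split_i mulrBl.
rewrite [RHS](eq_bigr (fun i => ('D_(X p) (fun y => in_chart c Y y 0 i) x * 'D_(e_ i) F x
    - 'D_(Y p) (fun y => in_chart c X y 0 i) x * 'D_(e_ i) F x) +
   (Y p 0 i * (\sum_j X p 0 j * 'D_(e_ j) ('D_(e_ i) F) x)
    - X p 0 i * (\sum_j Y p 0 j * 'D_(e_ j) ('D_(e_ i) F) x)))); last by move=> i _; ring.
rewrite [RHS]big_split -[LHS]addr0; congr (_ + _); apply/esym/eqP.
rewrite sumrB subr_eq0; apply/eqP.
under eq_bigr do rewrite mulr_sumr.
under [RHS]eq_bigr do rewrite mulr_sumr.
rewrite exchange_big /=; apply: eq_bigr => i _; apply: eq_bigr => j _.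
by rewrite (smooth_at_schwarz i j sF) mulrCA.
Qed.

End Fields.

(** * Bump functions and global extension of local objects *)

Section Bump.
Context {R : realType} {n : nat} {M : oriented_manifold R n}.
Implicit Types (c : chart R n M) (p q : M) (f : M -> R) (X Y : vfield M).

Local Notation e_ i := (delta_mx 0 i : 'rV[R]_n).

(** The norm on row vectors is the sup norm, which is not smooth; the squared Euclidean distance is
    polynomial and still controls it. *)
Let sqdist (x y : 'rV[R]_n) : R := \sum_i (y 0 i - x 0 i) * (y 0 i - x 0 i).

Let smooth_sqdist x y : smooth_at (sqdist x) y.
Proof.
apply: smooth_at_sum => i.
have s : smooth_at (fun y => y 0 i - x 0 i) y.
  by apply: smooth_atB; [exact: smooth_at_coord|exact: smooth_at_cst].
exact: smooth_atM.
Qed.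

Let norm_sqdist x y (r : R) : 0 <= r -> sqdist x y <= r ^+ 2 -> `|y - x| <= r.
Proof.
move=> r0 xy; apply: rV_norm_le => // i.
rewrite -(ler_pXn2r (ltn0Sn 1)) ?nnegrE // real_normK ?num_real //.
apply: le_trans xy; rewrite /sqdist (bigD1 i) //= !mxE expr2 lerDl.
by apply: sumr_ge0 => j _; rewrite -expr2 sqr_ge0.
Qed.

(** Vanishing in a whole neighbourhood of each point outside the chart, and not just at that point,
    is what makes products with objects smooth on the chart alone smooth everywhere. *)
Lemma bump c p : atlas c -> chart_dom c p -> exists f : M -> R,
  [/\ forall q, smooth_fun_at f q, f p = 1 &
      forall q, ~ chart_dom c q -> \forall q' \near q, f q' = 0].
Proof.
move=> cA cp; pose x := chart_map c p.
have : \forall y \near x, (chart_map c @` chart_dom c) y.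
  by apply: open_nbhs_nbhs; split; [exact: chart_img_open|exists p].
move=> /nbhs_ballP[d /= d0 xd].
(* Half the radius, so that the closed Euclidean ball [B] fits inside the open ball of radius
   [d]. *)
pose r := d / 2; have r0 : 0 < r by rewrite divr_gt0.
pose B := [set y | sqdist x y <= r ^+ 2].
have Bimg : B `<=` chart_map c @` chart_dom c.
  move=> y /(norm_sqdist (ltW r0)) xy; apply: xd.
  by rewrite -ball_normE /= distrC (le_lt_trans xy) // /r; lra.
have cB : compact B.
  apply: bounded_closed_compact.
    exists (`|x| + r); split; first exact: num_real.
    move=> m xrm y /(norm_sqdist (ltW r0)) xy; apply: le_trans (ltW xrm).
    by rewrite -[y](subrK x) addrC (le_trans (ler_normD _ _)) // lerD2l.
  apply: (@closed_comp _ _ (sqdist x) [set t | t <= r ^+ 2]); last exact: closed_le.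
  by move=> y _; exact/smooth_at_continuous/smooth_sqdist.
pose K := chart_inv c @` B.
(* Here the Hausdorff property enters: [K] is compact as a continuous image of [B], hence closed in
   the manifold, so that extension by zero is smooth also at boundary points of the chart. *)
have cK : closed K.
  apply: compact_closed (@points_hausdorff _ _ M) _.
  apply: continuous_compact cB.
  apply: continuous_in_subspaceT => y; rewrite inE => /Bimg yc.
  exact: chart_inv_continuous yc.
have Kc : K `<=` chart_dom c.
  by move=> _ [y /Bimg [q cq <-] <-]; rewrite chart_mapK.
pose F y := flat 0 (r ^+ 2 - sqdist x y).
have sF y : smooth_at F y.
  apply: (@smooth_at_flat _ _ 0 (fun y => r ^+ 2 - sqdist x y)).
  by apply: smooth_atB; [exact: smooth_at_cst|exact: smooth_sqdist].
have Fx : F x != 0.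
  rewrite /F /sqdist big1 => [|i _]; last by rewrite subrr mulr0.
  by rewrite subr0 gt_eqF // flat_gt0 // exprn_gt0.
pose f q := if pselect (chart_dom c q) then (F x)^-1 * F (chart_map c q) else 0.
have fE q : chart_dom c q -> f q = (F x)^-1 * F (chart_map c q).
  by rewrite /f; case: pselect.
have f0 q : ~ K q -> f q = 0.
  rewrite /f; case: pselect => // cq nKq.
  rewrite [F (chart_map c q)]flat_le0 ?mulr0 //.
  rewrite subr_le0 leNgt; apply/negP => qr.
  by apply: nKq; exists (chart_map c q); [exact: ltW|exact: chart_mapK].
have nearK q : ~ K q -> \forall q' \near q, f q' = 0.
  move=> nKq; have : \forall q' \near q, (~` K) q'.
    by apply: open_nbhs_nbhs; split => //; exact: closed_openC.
  by apply: filterS => q'; exact: f0.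
exists f; split.
- move=> q; have [cq|ncq] := pselect (chart_dom c q).
    apply: (@smooth_fun_at_near_eq _ _ _ (fun q => (F x)^-1 * (F \o chart_map c) q)).
      by apply: filterS (near_chart_dom cq) => q' /fE ->.
    apply: smooth_fun_atM; first exact: smooth_fun_at_cst.
    exact: smooth_fun_at_comp_chart.
  apply: (@smooth_fun_at_near_eq _ _ _ (fun=> 0)); last exact: smooth_fun_at_cst.
  by apply: filterS (nearK q _) => [q' ->//|/Kc].
- by rewrite fE // mulVf.
- by move=> q ncq; apply: nearK => /Kc.
Qed.

Lemma smooth_cutoff_fun c f u :
  (forall q, smooth_fun_at f q) ->
  (forall q, ~ chart_dom c q -> \forall q' \near q, f q' = 0) ->
  (forall q, chart_dom c q -> smooth_fun_at u q) ->
  forall q, smooth_fun_at (fun q => f q * u q) q.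
Proof.
move=> sf f0 su q; have [cq|ncq] := pselect (chart_dom c q).
  by apply: smooth_fun_atM => //; exact: su.
apply: (@smooth_fun_at_near_eq _ _ _ (fun=> 0)); last exact: smooth_fun_at_cst.
by apply: filterS (f0 q ncq) => q' ->; rewrite mul0r.
Qed.

Lemma smooth_cutoff_vfield c f X :
  (forall q, smooth_fun_at f q) ->
  (forall q, ~ chart_dom c q -> \forall q' \near q, f q' = 0) ->
  (forall q, chart_dom c q -> smooth_vfield_at X q) ->
  forall q, smooth_vfield_at (fun q => f q *: X q) q.
Proof.
move=> sf f0 sX q; have [cq|ncq] := pselect (chart_dom c q).
  by apply: smooth_vfield_atZ => //; exact: sX.
apply: (@smooth_vfield_at_near_eq _ _ _ (fun=> 0)); last exact: smooth_vfield_at0.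
by apply: filterS (f0 q ncq) => q' ->; rewrite scale0r.
Qed.

(** Neither the coordinate vectors nor the components of [X] are global. Each needs its own factor
    [f], whence the product [f q * f q]. *)
Lemma frame_at p : exists (f : M -> R) (E : 'I_n -> vfield M),
  [/\ smooth_fun f, f p = 1,
      forall i, smooth_vfield (E i),
      forall i, E i p = e_ i &
      forall X, smooth_vfield X -> exists phi : 'I_n -> M -> R,
        [/\ forall i, smooth_fun (phi i), forall i, phi i p = X p 0 i &
            forall q, (f q * f q) *: X q = \sum_i phi i q *: E i q]].
Proof.
have cA := chart_at_atlas p; have cp := chart_at_dom p.
have [f [sf fp f0]] := bump cA cp.
exists f, (fun i q => f q *: coord_vector (chart_at p) q i); split=> //.
- exact/smooth_funP.
- move=> i; apply/smooth_vfieldP; apply: smooth_cutoff_vfield sf f0 _ => q cq.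
  exact: smooth_vfield_at_coord.
- by move=> i; rewrite fp scale1r coord_vector_chart_at.
move=> X /smooth_vfieldP sX.
exists (fun i q => f q * comp_in (chart_at p) X q 0 i); split.
- move=> i; apply/smooth_funP; apply: smooth_cutoff_fun sf f0 _ => q cq.
  exact: sX.
- by move=> i; rewrite fp mul1r comp_in_chart_at.
move=> q; have [cq|ncq] := pselect (chart_dom (chart_at p) q).
  rewrite {1}(comp_in_coord_vector X cA cq) scaler_sumr; apply: eq_bigr => i _.
  by rewrite !scalerA mulrAC.
rewrite (nbhs_singleton (f0 q ncq)) mul0r scale0r big1 // => i _.
by rewrite !mul0r scale0r.
Qed.

(** A coordinate function lives on the chart only and is multiplied by a bump. Centring it at [p]
    kills the term in which the bump is differentiated. *)
Lemma dir_deriv_coord p i : exists f : M -> R, smooth_fun f /\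
  forall X, dir_deriv X f p = X p 0 i.
Proof.
have cA := chart_at_atlas p; have cp := chart_at_dom p.
set c := chart_at p in cA cp; have [f [sf fp f0]] := bump cA cp.
pose x i := chart_map c p 0 i.
pose h q := f q * (chart_map c q 0 i + - x i).
have su q : chart_dom c q -> smooth_fun_at (fun q => chart_map c q 0 i + - x i) q.
  move=> cq; apply: smooth_fun_atD; last exact: smooth_fun_at_cst.
  exact: smooth_fun_at_chart_map.
exists h; split; first by apply/smooth_funP; exact: smooth_cutoff_fun sf f0 su.
move=> X; rewrite /h dir_derivM //; last exact: su.
rewrite subrr mul0r addr0 fp mul1r dir_derivD; last exact: smooth_fun_at_cst.
  rewrite /dir_deriv -/c.
  rewrite (_ : (fun=> - x i) \o chart_inv c = cst (- x i)) // derive_cst addr0.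
  have E : \forall y \near chart_map c p, ((fun q => chart_map c q 0 i) \o chart_inv c) y = y 0 i.
    apply: (near_chart cp); apply: filterS (near_chart_dom cp) => q cq.
    by rewrite /= chart_mapK.
  by rewrite (near_eq_derive _ E); have [_ ->] := is_derive_coord i (chart_map c p) (X p).
exact: smooth_fun_at_chart_map.
Qed.

End Bump.

(** * The curvature tensor *)

Section CurvatureTensor.
Context {R : realType} {n : nat} {M : oriented_manifold R n}.
Implicit Types (p q : M) (f : M -> R) (X Y Z V W : vfield M).

Local Notation e_ i := (delta_mx 0 i : 'rV[R]_n).

Lemma smooth_fun_cst (k : R) : smooth_fun (fun=> k : R) (M := M).
Proof. by apply/smooth_funP => p; exact: smooth_fun_at_cst. Qed.

Lemma smooth_vfield0 : smooth_vfield (fun=> 0 : 'rV[R]_n) (M := M).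
Proof. by apply/smooth_vfieldP => p; exact: smooth_vfield_at0. Qed.

Lemma smooth_vfield_lin f X Y : smooth_fun f -> smooth_vfield X -> smooth_vfield Y ->
  smooth_vfield (fun q => f q *: X q + Y q).
Proof.
move=> /smooth_funP sf /smooth_vfieldP sX /smooth_vfieldP sY.
apply/smooth_vfieldP => p; apply: smooth_vfield_atD => //.
exact: smooth_vfield_atZ.
Qed.

Lemma smooth_vfield_scale f X : smooth_fun f -> smooth_vfield X ->
  smooth_vfield (fun q => f q *: X q).
Proof.
move=> /smooth_funP sf /smooth_vfieldP sX.
by apply/smooth_vfieldP => p; exact: smooth_vfield_atZ.
Qed.

Lemma smooth_vfield_sum (I : Type) (r : seq I) (phi : I -> M -> R) (E : I -> vfield M) :
  (forall i, smooth_fun (phi i)) -> (forall i, smooth_vfield (E i)) ->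
  smooth_vfield (fun q => \sum_(i <- r) phi i q *: E i q).
Proof.
move=> sphi sE; elim: r => [|i r IH].
  rewrite (_ : (fun _ => _) = fun=> 0); first exact: smooth_vfield0.
  by apply/funext => q; rewrite big_nil.
rewrite (_ : (fun _ => _) = fun q => phi i q *: E i q + \sum_(j <- r) phi j q *: E j q).
  exact: smooth_vfield_lin.
by apply/funext => q; rewrite big_cons.
Qed.

(** Evaluation at [p] is part of [T], so the coefficient comes out as the scalar [f p]. The notion
    applies to each argument of the curvature and to the first argument of the connection. *)
Definition tensorial (U : lmodType R) p (T : vfield M -> U) :=
  forall f X Y, smooth_fun f -> smooth_vfield X -> smooth_vfield Y ->
    T (fun q => f q *: X q + Y q) = f p *: T X + T Y.

Section Tensorial.
Variables (U : lmodType R) (p : M) (T : vfield M -> U).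
Hypothesis lT : tensorial p T.

Lemma tensorial0 : T (fun=> 0) = 0.
Proof.
have := lT (smooth_fun_cst 1) smooth_vfield0 smooth_vfield0.
rewrite !scale1r addr0 => E.
by apply: (@addrI _ (T (fun=> 0))); rewrite addr0 -E.
Qed.

Lemma tensorialZ f X : smooth_fun f -> smooth_vfield X ->
  T (fun q => f q *: X q) = f p *: T X.
Proof.
move=> sf sX; have := lT sf sX smooth_vfield0.
rewrite tensorial0 addr0 => <-; congr T.
by apply/funext => q; rewrite addr0.
Qed.

Lemma tensorial_sum (I : Type) (r : seq I) (phi : I -> M -> R) (E : I -> vfield M) :
  (forall i, smooth_fun (phi i)) -> (forall i, smooth_vfield (E i)) ->
  T (fun q => \sum_(i <- r) phi i q *: E i q) = \sum_(i <- r) phi i p *: T (E i).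
Proof.
move=> sphi sE; elim: r => [|i r IH].
  rewrite big_nil -tensorial0; congr T.
  by apply/funext => q; rewrite big_nil.
rewrite big_cons -IH -lT //; last exact: smooth_vfield_sum.
by congr T; apply/funext => q; rewrite big_cons.
Qed.

Lemma tensorial_pointwise X Y : smooth_vfield X -> smooth_vfield Y -> X p = Y p ->
  T X = T Y.
Proof.
move=> sX sY XY; have [f [E [sf fp sE _ dec]]] := frame_at p.
have TE Z : smooth_vfield Z -> T Z = \sum_i Z p 0 i *: T (E i).
  move=> sZ; have [phi [sphi phip dZ]] := dec Z sZ.
  have sfZ := smooth_vfield_scale sf sZ.
  have := tensorialZ sf sfZ; rewrite (tensorialZ sf sZ) fp !scale1r => <-.
  rewrite (_ : (fun _ => _) = fun q => \sum_i phi i q *: E i q).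
    by rewrite tensorial_sum //; apply: eq_bigr => i _; rewrite phip.
  by apply/funext => q; rewrite scalerA dZ.
by rewrite (TE X sX) (TE Y sY) XY.
Qed.

End Tensorial.

(** The choice in [extension] is never the default: a combination with constant coefficients of the
    frame at [p] passes through [v]. *)
Lemma extensionP p (v : 'rV[R]_n) :
  smooth_vfield (extension p v) /\ extension p v p = v.
Proof.
rewrite /extension; case: xgetP => [X -> //|noX].
have [f [E [sf fp sE Ep _]]] := frame_at p.
case: (noX (fun q => \sum_i v 0 i *: E i q)); split.
  by apply: smooth_vfield_sum => // i; exact: smooth_fun_cst.
rewrite [RHS](row_sum_delta v); apply: eq_bigr => i _.
by rewrite Ep.
Qed.

Lemma vector_ext p (v w : 'rV[R]_n) :
  (forall X Y f, smooth_fun f -> X p = v -> Y p = w -> dir_deriv X f p = dir_deriv Y f p) ->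
  v = w.
Proof.
move=> vw; apply/rowP => i; have [f [sf df]] := dir_deriv_coord p i.
(* Constant rows need not form smooth fields, as the reference chart varies; [dir_deriv] at [p]
   reads only their value there. *)
have := vw (fun=> v) (fun=> w) f sf erefl erefl.
by rewrite !df.
Qed.

Variables (g : metric M) (nabla : vfield M -> vfield M -> vfield M).
Hypothesis LC : levi_civita g nabla.

Let Cn := levi_civita_connection LC.

Local Notation Br := lie_bracket.
Local Notation K := (curvature nabla).

Let sN X Y : smooth_vfield X -> smooth_vfield Y -> smooth_vfield (nabla X Y).
Proof. exact: connection_smooth Cn X Y. Qed.

Let nablaL X p : smooth_vfield X -> tensorial p (fun Y => nabla Y X p).
Proof. by move=> sX f Y Z sf sY sZ; exact: connection_linear Cn f Y Z X sf sY sZ sX p. Qed.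

Let nablaR X f Y Z p : smooth_fun f -> smooth_vfield X -> smooth_vfield Y -> smooth_vfield Z ->
  nabla X (fun q => f q *: Y q + Z q) p =
    dir_deriv X f p *: Y p + f p *: nabla X Y p + nabla X Z p.
Proof.
move=> sf sX sY sZ.
rewrite (connection_additive Cn sX (smooth_vfield_scale sf sY) sZ).
by rewrite (connection_leibniz Cn sf sX sY).
Qed.

(** Torsion freeness trades brackets for covariant derivatives, so smoothness of the bracket and its
    behaviour under scaling come from the axioms of the connection. *)
Let BrE X Y : smooth_vfield X -> smooth_vfield Y ->
  Br X Y = fun q => (-1) *: nabla Y X q + nabla X Y q.
Proof.
move=> sX sY; apply/funext => q.
by rewrite -(levi_civita_torsion_free LC sX sY) scaleN1r addrC.
Qed.

Let sBr X Y : smooth_vfield X -> smooth_vfield Y -> smooth_vfield (Br X Y).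
Proof.
move=> sX sY; rewrite BrE //; apply: smooth_vfield_lin; try exact: sN.
exact: smooth_fun_cst.
Qed.

Let sD X f : smooth_vfield X -> smooth_fun f -> smooth_fun (dir_deriv X f).
Proof.
move=> /smooth_vfieldP sX /smooth_funP sf; apply/smooth_funP => p.
exact: smooth_dir_deriv.
Qed.

Let dBr X Y f p : smooth_vfield X -> smooth_vfield Y -> smooth_fun f ->
  dir_deriv (Br X Y) f p = dir_deriv X (dir_deriv Y f) p - dir_deriv Y (dir_deriv X f) p.
Proof.
move=> /smooth_vfieldP sX /smooth_vfieldP sY /smooth_funP sf.
exact: lie_bracket_dir_deriv.
Qed.

Let nabla_opp X Y p : smooth_vfield X -> smooth_vfield Y ->
  nabla (fun q => - X q) Y p = - nabla X Y p.
Proof.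
move=> sX sY; have := tensorialZ (@nablaL Y p sY) (smooth_fun_cst (-1)) sX.
by rewrite scaleN1r => <-; congr nabla; apply/funext => q; rewrite scaleN1r.
Qed.

Lemma curvature_anti X Y Z p : smooth_vfield X -> smooth_vfield Y -> smooth_vfield Z ->
  K X Y Z p = - K Y X Z p.
Proof.
move=> sX sY sZ; rewrite /curvature.
have -> : Br X Y = fun q => - Br Y X q.
  by apply/funext => q; rewrite /lie_bracket opprB.
rewrite nabla_opp //; last exact: sBr.
by apply/rowP => j; rewrite !mxE; ring.
Qed.

(** Terms with one derivative of [f] are symmetric in [X] and [Y] and cancel; those with two
    derivatives cancel against the derivative of [f] along the bracket, by [dBr]. *)
Lemma curvature_tensorial3 X Y p : smooth_vfield X -> smooth_vfield Y ->
  tensorial p (fun Z => K X Y Z p).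
Proof.
move=> sX sY f Z Z' sf sZ sZ'; rewrite /curvature.
have E V : smooth_vfield V -> nabla V (fun q => f q *: Z q + Z' q) =
  fun q => dir_deriv V f q *: Z q + (fun q => f q *: nabla V Z q + nabla V Z' q) q.
  by move=> sV; apply/funext => q; rewrite nablaR // addrA.
rewrite (E X sX) (E Y sY) (E _ (sBr sX sY)).
have sL V : smooth_vfield V -> smooth_vfield (fun q => f q *: nabla V Z q + nabla V Z' q).
  by move=> sV; apply: smooth_vfield_lin => //; exact: sN.
rewrite [nabla X _ p]nablaR ?[nabla Y _ p]nablaR //; try exact: sL; try exact: sD.
rewrite [nabla X (fun q => f q *: _ + _) p]nablaR ?[nabla Y (fun q => f q *: _ + _) p]nablaR //;
  try exact: sN.
have := dBr p sX sY sf; set d := dir_deriv (Br X Y) f p => ->.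
generalize (dir_deriv X (dir_deriv Y f) p) (dir_deriv Y (dir_deriv X f) p).
generalize (dir_deriv X f p) (dir_deriv Y f p) => dX dY dXY dYX.
by apply/rowP => j; rewrite !mxE; ring.
Qed.

(** The bracket of [f X] with [Y] contains an extra [- (Y f) X], which cancels the Leibniz term of
    [nabla Y (nabla (f X) Z)]. *)
Lemma curvature_tensorial1 Y Z p : smooth_vfield Y -> smooth_vfield Z ->
  tensorial p (fun X => K X Y Z p).
Proof.
move=> sY sZ f X X' sf sX sX'; rewrite /curvature.
pose fX q := f q *: X q + X' q; rewrite -/fX.
have sfX : smooth_vfield fX by exact: smooth_vfield_lin.
have -> : nabla fX Z = fun q => f q *: nabla X Z q + nabla X' Z q.
  by apply/funext => q; rewrite /fX (nablaL q sZ).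
have -> : Br fX Y = fun q => f q *: Br X Y q +
    (fun q => - dir_deriv Y f q *: X q + Br X' Y q) q.
  apply/funext => q; rewrite !BrE // /fX (nablaL q sY) // nablaR //.
  by apply/rowP => j; rewrite !mxE; ring.
have sNf : smooth_fun (fun q => - dir_deriv Y f q).
  rewrite (_ : (fun _ => _) = fun q => -1 * dir_deriv Y f q); last first.
    by apply/funext => q; rewrite mulN1r.
  apply/smooth_funP => q; apply: smooth_fun_atM; first exact: smooth_fun_at_cst.
  by have /smooth_funP := sD sY sf; apply.
have sX'Y := sBr sX' sY; have sXY := sBr sX sY.
rewrite (nablaL p sZ sf sXY (smooth_vfield_lin sNf sX sX'Y)).
rewrite (nablaL p sZ sNf sX sX'Y) /fX.
rewrite (nablaL p (sN sY sZ)) // (nablaR p sf sY (sN sX sZ) (sN sX' sZ)).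
cbv beta; generalize (dir_deriv Y f p) (nabla (Br X Y) Z p) (nabla (Br X' Y) Z p) => dY BXY BX'Y.
by apply/rowP => j; rewrite !mxE; ring.
Qed.

Lemma curvature_tensorial2 X Z p : smooth_vfield X -> smooth_vfield Z ->
  tensorial p (fun Y => K X Y Z p).
Proof.
move=> sX sZ f Y Y' sf sY sY'.
rewrite curvature_anti //; last exact: smooth_vfield_lin.
rewrite (curvature_tensorial1 p sX sZ sf sY sY').
by rewrite (curvature_anti p sY sX sZ) (curvature_anti p sY' sX sZ) scalerN -opprD opprK.
Qed.

(** The function [g (Z, W)] is differentiated along the bracket of [X] and [Y] in two ways. By
    metric compatibility, products with one derivative on each factor are symmetric in [X], [Y] and
    drop out; what remains is the curvature acting on [Z] plus that acting on [W]. *)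
Lemma curvature_skew X Y Z W p :
  smooth_vfield X -> smooth_vfield Y -> smooth_vfield Z -> smooth_vfield W ->
  g p (K X Y Z p) (W p) = - g p (Z p) (K X Y W p).
Proof.
move=> sX sY sZ sW.
have sg V V' q : smooth_vfield V -> smooth_vfield V' ->
    smooth_fun_at (fun q => g q (V q) (V' q)) q.
  by move=> /smooth_vfieldP sV /smooth_vfieldP sV'; exact: smooth_inner.
have D V : smooth_vfield V -> dir_deriv V (fun q => g q (Z q) (W q)) =
   fun q => g q (nabla V Z q) (W q) + g q (Z q) (nabla V W q).
  by move=> sV; apply/funext => q; exact: (levi_civita_metric LC).
have DD V V' : smooth_vfield V -> smooth_vfield V' ->
   dir_deriv V (dir_deriv V' (fun q => g q (Z q) (W q))) p =
   g p (nabla V (nabla V' Z) p) (W p) + g p (nabla V' Z p) (nabla V W p) +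
   (g p (nabla V Z p) (nabla V' W p) + g p (Z p) (nabla V (nabla V' W) p)).
  move=> sV sV'; rewrite (D V' sV') dir_derivD; [|exact/sg/sW/sN|by apply: sg => //; exact: sN].
  by congr (_ + _); apply: (levi_civita_metric LC) => //; exact: sN.
have sgZW : smooth_fun (fun q => g q (Z q) (W q)).
  by apply/smooth_funP => q; exact: sg.
have := dBr p sX sY sgZW.
rewrite (D _ (sBr sX sY)) (DD X Y sX sY) (DD Y X sY sX) => E.
have gB (a b c w : 'rV[R]_n) : g p (a - b - c) w = g p a w - g p b w - g p c w.
  rewrite -[a - b - c]addrA -opprD -scaleN1r addrC inner_linear.
  by rewrite -[b in b + c]scale1r inner_linear; ring.
have gB' (a b c w : 'rV[R]_n) : g p w (a - b - c) = g p w a - g p w b - g p w c.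
  by rewrite !(innerC _ _ w) gB.
by rewrite /curvature gB gB'; lra.
Qed.

Lemma jacobi X Y Z p : smooth_vfield X -> smooth_vfield Y -> smooth_vfield Z ->
  Br X (Br Y Z) p + Br Y (Br Z X) p + Br Z (Br X Y) p = 0.
Proof.
move=> sX sY sZ; apply: (@vector_ext p) => V W f sf Vp Wp.
have sXYZ := sBr sX (sBr sY sZ); have sYZX := sBr sY (sBr sZ sX).
have /smooth_funP sfp := sf.
(* As [W p = 0], also [W p = - W p + W p], and linearity in the direction makes the derivative along
   [W] vanish. *)
have EW := @dir_deriv_lin _ _ _ (-1) W W W f p (sfp p).
have {}EW : dir_deriv W f p = 0.
  have -> := EW _; last by rewrite Wp scaler0 addr0.
  by rewrite mulN1r addNr.
have EV := @dir_deriv_lin _ _ _ 1 (Br X (Br Y Z))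
  (fun q => 1 *: Br Y (Br Z X) q + Br Z (Br X Y) q) V f p (sfp p).
have VE : V p = 1 *: Br X (Br Y Z) p + (1 *: Br Y (Br Z X) p + Br Z (Br X Y) p).
  apply: etrans Vp _.
  generalize (Br X (Br Y Z) p) (Br Y (Br Z X) p) (Br Z (Br X Y) p) => A B C.
  by rewrite !scale1r addrA.
have {VE}EV := EV VE.
have EYZX := @dir_deriv_lin _ _ _ 1 (Br Y (Br Z X)) (Br Z (Br X Y))
  (fun q => 1 *: Br Y (Br Z X) q + Br Z (Br X Y) q) f p (sfp p) erefl.
(* Each double bracket acts through four triple derivatives; the twelve terms of the cyclic sum
   cancel in pairs. *)
have dDB V1 V2 V3 : smooth_vfield V1 -> smooth_vfield V2 -> smooth_vfield V3 ->
  dir_deriv (Br V1 (Br V2 V3)) f p =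
   dir_deriv V1 (dir_deriv V2 (dir_deriv V3 f)) p -
   dir_deriv V1 (dir_deriv V3 (dir_deriv V2 f)) p -
   (dir_deriv V2 (dir_deriv V3 (dir_deriv V1 f)) p -
    dir_deriv V3 (dir_deriv V2 (dir_deriv V1 f)) p).
  move=> s1 s2 s3; rewrite (dBr p s1 (sBr s2 s3) sf); congr (_ - _); last exact/dBr/sD.
  rewrite (_ : dir_deriv (Br V2 V3) f = fun q => dir_deriv V2 (dir_deriv V3 f) q +
     (fun q => (-1) * dir_deriv V3 (dir_deriv V2 f) q) q); last first.
    by apply/funext => q; rewrite (dBr q s2 s3 sf) mulN1r.
  have sF V4 V5 q : smooth_vfield V4 -> smooth_vfield V5 ->
      smooth_fun_at (dir_deriv V4 (dir_deriv V5 f)) q.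
    by move=> s4 s5; have /smooth_funP := sD s4 (sD s5 sf).
  rewrite dir_derivD; [|exact: sF|]; last first.
    by apply: smooth_fun_atM; [exact: smooth_fun_at_cst|exact: sF].
  congr (_ + _); rewrite dir_derivM; [|exact: smooth_fun_at_cst|exact: sF].
  by rewrite mulN1r [dir_deriv V1 (fun=> -1) p]derive_cst mulr0 addr0.
apply: etrans (etrans EV (congr2 +%R (congr1 ( *%R 1) (dDB X Y Z sX sY sZ)) (etrans EYZX
  (congr2 +%R (congr1 ( *%R 1) (dDB Y Z X sY sZ sX)) (dDB Z X Y sZ sX sY))))) (etrans _ (esym EW)).
generalize (dir_deriv X (dir_deriv Y (dir_deriv Z f)) p)
  (dir_deriv X (dir_deriv Z (dir_deriv Y f)) p)
  (dir_deriv Y (dir_deriv Z (dir_deriv X f)) p)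
  (dir_deriv Y (dir_deriv X (dir_deriv Z f)) p)
  (dir_deriv Z (dir_deriv X (dir_deriv Y f)) p)
  (dir_deriv Z (dir_deriv Y (dir_deriv X f)) p).
by move=> *; ring.
Qed.

(** Torsion freeness expands each double bracket of the Jacobi identity into three covariant terms;
    the nine terms obtained are those of the three curvatures, grouped differently. *)
Lemma curvature_bianchi X Y Z p :
  smooth_vfield X -> smooth_vfield Y -> smooth_vfield Z ->
  K X Y Z p + K Y Z X p + K Z X Y p = 0.
Proof.
move=> sX sY sZ; rewrite -(jacobi p sX sY sZ) /curvature.
have E V1 V2 V3 : smooth_vfield V1 -> smooth_vfield V2 -> smooth_vfield V3 ->
  Br V1 (Br V2 V3) p = nabla V1 (nabla V2 V3) p - nabla V1 (nabla V3 V2) p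
    - nabla (Br V2 V3) V1 p.
  move=> s1 s2 s3; rewrite -(levi_civita_torsion_free LC s1 (sBr s2 s3)).
  congr (_ - _); rewrite (BrE s2 s3).
  rewrite nablaR ?scaleN1r; [|exact: smooth_fun_cst|exact: s1|exact: sN|exact: sN].
  by rewrite [dir_deriv V1 (fun=> -1) p]derive_cst scale0r add0r addrC.
by rewrite !E //; apply/rowP => j; rewrite !mxE; ring.
Qed.

End CurvatureTensor.

(** * Algebraic symmetries of the Riemann tensor at a point *)

Section RiemannTensor.
Context {R : realType} {n : nat} {M : oriented_manifold R n}.
Variables (g : metric M) (nabla : vfield M -> vfield M -> vfield M).
Hypothesis LC : levi_civita g nabla.
Variable p : M.
Implicit Types (a : R) (u v w x y : 'rV[R]_n) (V W X : vfield M).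

Local Notation K := (curvature nabla).
Local Notation Rm := (Rm g nabla p).
Local Notation ext := (extension p).

Let sext v : smooth_vfield (ext v). Proof. by have [] := extensionP p v. Qed.
Let extE v : ext v p = v. Proof. by have [] := extensionP p v. Qed.

Let tens1 Y Z (sY : smooth_vfield Y) (sZ : smooth_vfield Z) :=
  @curvature_tensorial1 _ _ _ _ _ LC Y Z p sY sZ.
Let tens2 X Z (sX : smooth_vfield X) (sZ : smooth_vfield Z) :=
  @curvature_tensorial2 _ _ _ _ _ LC X Z p sX sZ.
Let tens3 X Y (sX : smooth_vfield X) (sY : smooth_vfield Y) :=
  @curvature_tensorial3 _ _ _ _ _ LC X Y p sX sY.

(** The extension chosen for [a *: u + v] is unrelated to the combination of the two extensions
    except at [p], which is all a tensorial map sees. *)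
Let ext_lin (T : vfield M -> 'rV[R]_n) a u v : tensorial p T ->
  T (ext (a *: u + v)) = a *: T (ext u) + T (ext v).
Proof.
move=> lT; rewrite -(lT (fun=> a)) //; last exact: smooth_fun_cst.
apply: (tensorial_pointwise lT) => //; last by rewrite !extE.
by apply: smooth_vfield_lin => //; exact: smooth_fun_cst.
Qed.

Lemma Rm_linear1 a u v w x y :
  Rm (a *: u + v) w x y = a * Rm u w x y + Rm v w x y.
Proof. by rewrite /Rm (ext_lin _ _ _ (tens1 _ _)) // inner_linear. Qed.

Lemma Rm_linear2 a u v w x y :
  Rm w (a *: u + v) x y = a * Rm w u x y + Rm w v x y.
Proof. by rewrite /Rm (ext_lin _ _ _ (tens2 _ _)) // inner_linear. Qed.

Lemma Rm_linear3 a u v w x y :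
  Rm w x (a *: u + v) y = a * Rm w x u y + Rm w x v y.
Proof. by rewrite /Rm (ext_lin _ _ _ (tens3 _ _)) // inner_linear. Qed.

Lemma Rm_linear4 a u v w x y :
  Rm w x y (a *: u + v) = a * Rm w x y u + Rm w x y v.
Proof. by rewrite /Rm !(innerC g p (K _ _ _ _)) inner_linear. Qed.

Let innerN u v : g p (- u) v = - g p u v.
Proof.
have := inner_linear g p (-1) u 0 v.
have := inner_linear g p (-1) 0 0 v.
by rewrite scaler0 !addr0 !mulN1r scaleN1r addNr => ->; rewrite addr0.
Qed.

Lemma Rm_anti12 v w x y : Rm v w x y = - Rm w v x y.
Proof. by rewrite /Rm (curvature_anti LC) // innerN. Qed.

Lemma Rm_anti34 v w x y : Rm v w x y = - Rm v w y x.
Proof.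
rewrite /Rm -[in LHS](extE y) (curvature_skew LC) // extE.
by rewrite [in LHS]innerC.
Qed.

Lemma Rm_bianchi v w x y : Rm v w x y + Rm w x v y + Rm x v w y = 0.
Proof.
have B := curvature_bianchi LC p (sext v) (sext w) (sext x).
have := congr1 (fun u => g p u y) B; rewrite /Rm.
rewrite -[K (ext v) _ _ p]scale1r -[K (ext w) _ _ p]scale1r.
rewrite -addrA !inner_linear !mul1r !scale1r addrA => ->.
have := inner_linear g p (-1) 0 0 y.
by rewrite scaler0 addr0 mulN1r addNr.
Qed.

(** Four instances of the Bianchi identity, one for each argument kept in last place. The skew
    symmetries bring their terms to common representatives, and the pair symmetry is then a linear
    consequence. *)
Lemma Rm_pair v w x y : Rm v w x y = Rm x y v w.
Proof.
have B1 := Rm_bianchi w x v y; have B2 := Rm_bianchi x v y w.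
have B3 := Rm_bianchi v y w x; have B4 := Rm_bianchi y w x v.
rewrite [Rm x v y w]Rm_anti34 [Rm v y x w]Rm_anti34 [Rm y x v w]Rm_anti12 in B2.
rewrite [Rm y w v x]Rm_anti34 [Rm w v y x]Rm_anti12 [Rm v w y x]Rm_anti34 in B3.
rewrite [Rm w x y v]Rm_anti34 [Rm x y w v]Rm_anti34 in B4.
lra.
Qed.

End RiemannTensor.

(** * Bivectors and the Hodge star *)

Section BivectorForms.
Context {R : realType} {n : nat}.
Implicit Types (a : R) (u v w x y : 'rV[R]_n) (xi eta zeta : bivector R n).

Local Notation V := 'rV[R]_n.
Local Notation e_ i := (delta_mx 0 i : 'rV[R]_n).

Record multilinear4 (T : V -> V -> V -> V -> R) : Prop := Multilinear4 {
  multilinear4_1 : forall a u v w x y,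
    T (a *: u + v) w x y = a * T u w x y + T v w x y;
  multilinear4_2 : forall a u v w x y,
    T w (a *: u + v) x y = a * T w u x y + T w v x y;
  multilinear4_3 : forall a u v w x y,
    T w x (a *: u + v) y = a * T w x u y + T w x v y;
  multilinear4_4 : forall a u v w x y,
    T w x y (a *: u + v) = a * T w x y u + T w x y v
}.

Lemma functional_sum (L : V -> R) : (forall a u v, L (a *: u + v) = a * L u + L v) ->
  forall v, L v = \sum_i v 0 i * L (e_ i).
Proof.
move=> lL v; have L0 : L 0 = 0.
  by have := lL (-1) 0 0; rewrite scaler0 addr0 mulN1r addNr.
rewrite [in LHS](row_sum_delta v).
elim/big_rec2: _ => [|i s u _ IH]; first exact: L0.
by rewrite lL -IH.
Qed.

Lemma bivector_addE xi eta i j : (xi + eta) i j = xi i j + eta i j.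
Proof. by rewrite -[bivector_mx _]/(bivector_mx xi + bivector_mx eta) mxE. Qed.

Lemma bivector_scaleE a xi i j : (a *: xi) i j = a * xi i j.
Proof. by rewrite -[bivector_mx _]/(a *: bivector_mx xi) mxE. Qed.

Lemma wedgeE u v i j : (wedge u v) i j = u 0 i * v 0 j - v 0 i * u 0 j.
Proof. by rewrite !mxE !big_ord1 !mxE. Qed.

Lemma bivectorP xi eta : (forall i j, xi i j = eta i j) -> xi = eta.
Proof. by move=> E; apply: val_inj; apply/matrixP. Qed.

Lemma wedgeDr u v w : wedge u (v + w) = wedge u v + wedge u w.
Proof. by apply: bivectorP => i j; rewrite bivector_addE !wedgeE !mxE; ring. Qed.

Lemma wedgeDl u v w : wedge (u + v) w = wedge u w + wedge v w.
Proof. by apply: bivectorP => i j; rewrite bivector_addE !wedgeE !mxE; ring. Qed.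

Lemma wedgeNl u v : wedge (- u) v = wedge v u.
Proof. by apply: bivectorP => i j; rewrite !wedgeE !mxE; ring. Qed.

Lemma wedgeZl a u v : wedge (a *: u) v = a *: wedge u v.
Proof. by apply: bivectorP => i j; rewrite bivector_scaleE !wedgeE !mxE; ring. Qed.

Lemma bivector_form_linear1 T a xi eta zeta :
  bivector_form T (a *: xi + eta) zeta =
    a * bivector_form T xi zeta + bivector_form T eta zeta.
Proof.
rewrite /bivector_form mulrCA -mulrDr; congr (_ * _).
rewrite mulr_sumr -big_split; apply: eq_bigr => i _.
rewrite mulr_sumr -big_split; apply: eq_bigr => j _.
rewrite mulr_sumr -big_split; apply: eq_bigr => k _.
rewrite mulr_sumr -big_split; apply: eq_bigr => l _.
by rewrite bivector_addE bivector_scaleE /=; ring.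
Qed.

Lemma bivector_form_linear2 T a xi eta zeta :
  bivector_form T zeta (a *: xi + eta) =
    a * bivector_form T zeta xi + bivector_form T zeta eta.
Proof.
rewrite /bivector_form mulrCA -mulrDr; congr (_ * _).
rewrite mulr_sumr -big_split; apply: eq_bigr => i _.
rewrite mulr_sumr -big_split; apply: eq_bigr => j _.
rewrite mulr_sumr -big_split; apply: eq_bigr => k _.
rewrite mulr_sumr -big_split; apply: eq_bigr => l _.
by rewrite bivector_addE bivector_scaleE /=; ring.
Qed.

Lemma bivector_formC T : (forall v w x y, T v w x y = T x y v w) ->
  forall xi eta, bivector_form T xi eta = bivector_form T eta xi.
Proof.
move=> TC xi eta; rewrite /bivector_form; congr (_ * _).
transitivity (\sum_i \sum_k \sum_l \sum_j xi i j * eta k l * T (e_ i) (e_ j) (e_ k) (e_ l)).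
  apply: eq_bigr => i _; rewrite exchange_big; apply: eq_bigr => k _.
  exact: exchange_big.
rewrite exchange_big; apply: eq_bigr => k _.
rewrite exchange_big; apply: eq_bigr => l _; apply: eq_bigr => i _.
by apply: eq_bigr => j _; rewrite TC [xi i j * _]mulrC.
Qed.

(** Each wedge is a difference of two products, so the sum is made of four values of [T], all equal
    by antisymmetry once their signs are counted: this is what [4^-1] compensates. *)
Lemma bivector_form_wedge T : multilinear4 T ->
  (forall v w x y, T v w x y = - T w v x y) ->
  (forall v w x y, T v w x y = - T v w y x) ->
  forall v w x y, bivector_form T (wedge v w) (wedge x y) = T v w x y.
Proof.
move=> mT a12 a34 v w x y.
have T1 u v' x' y' : T u v' x' y' = \sum_i u 0 i * T (e_ i) v' x' y'.
  exact: (functional_sum (fun a u v => multilinear4_1 mT a u v v' x' y')).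
have T2 u v' x' y' : T v' u x' y' = \sum_i u 0 i * T v' (e_ i) x' y'.
  exact: (functional_sum (fun a u v => multilinear4_2 mT a u v v' x' y')).
have T3 u v' x' y' : T v' x' u y' = \sum_i u 0 i * T v' x' (e_ i) y'.
  exact: (functional_sum (fun a u v => multilinear4_3 mT a u v v' x' y')).
have T4 u v' x' y' : T v' x' y' u = \sum_i u 0 i * T v' x' y' (e_ i).
  exact: (functional_sum (fun a u v => multilinear4_4 mT a u v v' x' y')).
have E (u u' z z' : V) : \sum_i \sum_j \sum_k \sum_l u 0 i * u' 0 j * z 0 k * z' 0 l *
    T (e_ i) (e_ j) (e_ k) (e_ l) = T u u' z z'.
  rewrite [RHS]T1; apply: eq_bigr => i _.
  rewrite [in RHS]T2 mulr_sumr; apply: eq_bigr => j _.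
  rewrite [in RHS]T3 !mulr_sumr; apply: eq_bigr => k _.
  rewrite [in RHS]T4 !mulr_sumr; apply: eq_bigr => l _.
  by ring.
have -> : bivector_form T (wedge v w) (wedge x y) =
   4^-1 * (T v w x y - T w v x y - T v w y x + T w v y x).
  rewrite /bivector_form; congr (_ * _).
  rewrite -!E -!sumrB -big_split; apply: eq_bigr => i _.
  rewrite -!sumrB -big_split; apply: eq_bigr => j _.
  rewrite -!sumrB -big_split; apply: eq_bigr => k _.
  rewrite -!sumrB -big_split; apply: eq_bigr => l _.
  by rewrite !wedgeE /=; ring.
rewrite (a12 w v x y) (a34 v w y x) (a12 w v y x) (a34 v w y x).
by field.
Qed.

End BivectorForms.

(** * The wedge pairing as a determinant *)

Section Wedge4.
Context {R : realType}.
Implicit Types (v w x y : 'rV[R]_4) (xi eta : bivector R 4).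

Definition rows4 v w x y : 'M[R]_4 :=
  \matrix_i nth 0 [:: v; w; x; y] i.

Definition det4 v w x y : R := \det (rows4 v w x y).

(** On basis rows the Leibniz formula keeps only the permutations sending [0, 1, 2, 3] to
    [i, j, k, l]. This places [wedge4] under the general lemmas on [bivector_form]. *)
Lemma wedge4E xi eta : wedge4 xi eta = bivector_form det4 xi eta.
Proof.
rewrite /wedge4 /bivector_form /det4 /determinant; congr (_ * _).
set o0 := Ordinal _; set o1 := Ordinal _; set o2 := Ordinal _; set o3 := Ordinal _.
have E i j k l (s : 'S_4) : \prod_i0 rows4 (delta_mx 0 i) (delta_mx 0 j) (delta_mx 0 k)
    (delta_mx 0 l) i0 (s i0) =
    (s o0 == i)%:R * (s o1 == j)%:R * (s o2 == k)%:R * (s o3 == l)%:R :> R.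
  rewrite !big_ord_recl big_ord0 !mxE /= mulr1 !mulrA.
  by congr ((s _ == _)%:R * (s _ == _)%:R * (s _ == _)%:R * (s _ == _)%:R); exact: val_inj.
under [RHS]eq_bigr => i _ do under eq_bigr => j _ do under eq_bigr => k _ do
  under eq_bigr => l _ do rewrite mulr_sumr.
have X (F : 'I_4 -> 'I_4 -> 'I_4 -> 'I_4 -> 'S_4 -> R) :
    \sum_i \sum_j \sum_k \sum_l \sum_s F i j k l s =
    \sum_s \sum_i \sum_j \sum_k \sum_l F i j k l s.
  rewrite [RHS]exchange_big; apply: eq_bigr => i _.
  rewrite [RHS]exchange_big; apply: eq_bigr => j _.
  rewrite [RHS]exchange_big; apply: eq_bigr => k _.
  by rewrite [RHS]exchange_big; apply: eq_bigr => l _.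
rewrite X; apply: eq_bigr => s _; apply: esym.
have D (t : 'I_4) (F : 'I_4 -> R) : \sum_i F i * (t == i)%:R = F t.
  rewrite (bigD1 t) //= eqxx mulr1 big1 ?addr0 // => i it.
  by rewrite eq_sym (negbTE it) mulr0.
under eq_bigr => i _ do under eq_bigr => j _ do under eq_bigr => k _ do
  under eq_bigr => l _ do rewrite E.
transitivity (\sum_i (\sum_j (\sum_k (\sum_l ((-1) ^+ s * xi i j * eta k l) * (s o3 == l)%:R)
    * (s o2 == k)%:R) * (s o1 == j)%:R) * (s o0 == i)%:R).
  apply: eq_bigr => i _; rewrite mulr_suml; apply: eq_bigr => j _.
  rewrite !mulr_suml; apply: eq_bigr => k _.
  rewrite !mulr_suml; apply: eq_bigr => l _.
  move: (xi i j) (eta k l) (s o0 == i) (s o1 == j) (s o2 == k) (s o3 == l) => a b b0 b1 b2 b3.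
  move: ((-1) ^+ s : R) => c; move: (b0%:R : R) (b1%:R : R) (b2%:R : R) (b3%:R : R).
  by move=> *; ring.
by rewrite !D.
Qed.

End Wedge4.

Section Det4.
Context {R : realType}.
Implicit Types (v w x y : 'rV[R]_4).

Lemma det4_alternate v w x y (i j : 'I_4) : i != j ->
  nth 0 [:: v; w; x; y] i = nth 0 [:: v; w; x; y] j -> det4 v w x y = 0.
Proof.
move=> ij E; apply: (determinant_alternate ij) => k.
by rewrite !mxE E.
Qed.

Lemma det4_multilinear : multilinear4 (@det4 R).
Proof.
split=> a u v w x y; rewrite /det4.
- rewrite (@determinant_multilinear _ _ _ (rows4 u w x y) (rows4 v w x y)
    (@Ordinal 4 0 isT) a 1) ?mul1r //.
  + by apply/rowP => k; rewrite !mxE mul1r.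
  + by apply/matrixP => i k; rewrite !mxE; case: i => [[|[|[|i]]] hi].
  + by apply/matrixP => i k; rewrite !mxE; case: i => [[|[|[|i]]] hi].
- rewrite (@determinant_multilinear _ _ _ (rows4 w u x y) (rows4 w v x y)
    (@Ordinal 4 1 isT) a 1) ?mul1r //.
  + by apply/rowP => k; rewrite !mxE mul1r.
  + by apply/matrixP => i k; rewrite !mxE; case: i => [[|[|[|i]]] hi].
  + by apply/matrixP => i k; rewrite !mxE; case: i => [[|[|[|i]]] hi].
- rewrite (@determinant_multilinear _ _ _ (rows4 w x u y) (rows4 w x v y)
    (@Ordinal 4 2 isT) a 1) ?mul1r //.
  + by apply/rowP => k; rewrite !mxE mul1r.
  + by apply/matrixP => i k; rewrite !mxE; case: i => [[|[|[|i]]] hi].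
  + by apply/matrixP => i k; rewrite !mxE; case: i => [[|[|[|i]]] hi].
- rewrite (@determinant_multilinear _ _ _ (rows4 w x y u) (rows4 w x y v)
    (@Ordinal 4 3 isT) a 1) ?mul1r //.
  + by apply/rowP => k; rewrite !mxE mul1r.
  + by apply/matrixP => i k; rewrite !mxE; case: i => [[|[|[|i]]] hi].
  + by apply/matrixP => i k; rewrite !mxE; case: i => [[|[|[|i]]] hi].
Qed.

(** Polarization of an alternating map; the coefficient [1] matches the shape of the fields of
    [multilinear4]. *)
Let polar (f : 'rV[R]_4 -> 'rV[R]_4 -> R) :
  (forall u v w, f (1 *: u + v) w = 1 * f u w + f v w) ->
  (forall u v w, f w (1 *: u + v) = 1 * f w u + f w v) ->
  (forall v, f v v = 0) -> forall v w, f v w = - f w v.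
Proof.
move=> l1 l2 alt v w; have := alt (1 *: v + w).
rewrite l1 !l2 !alt !mul1r add0r addr0 => /eqP.
by rewrite addr_eq0 => /eqP.
Qed.

Lemma det4_anti12 v w x y : det4 v w x y = - det4 w v x y.
Proof.
apply: (@polar (fun v w => det4 v w x y)) => [u u' z|u u' z|u].
- exact: multilinear4_1 det4_multilinear _ _ _ _ _ _.
- exact: multilinear4_2 det4_multilinear _ _ _ _ _ _.
- exact: (@det4_alternate _ _ _ _ (@Ordinal 4 0 isT) (@Ordinal 4 1 isT)).
Qed.

Lemma det4_anti23 v w x y : det4 v w x y = - det4 v x w y.
Proof.
apply: (@polar (fun w x => det4 v w x y)) => [u u' z|u u' z|u].
- exact: multilinear4_2 det4_multilinear _ _ _ _ _ _.
- exact: multilinear4_3 det4_multilinear _ _ _ _ _ _.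
- exact: (@det4_alternate _ _ _ _ (@Ordinal 4 1 isT) (@Ordinal 4 2 isT)).
Qed.

Lemma det4_anti34 v w x y : det4 v w x y = - det4 v w y x.
Proof.
apply: (@polar (fun x y => det4 v w x y)) => [u u' z|u u' z|u].
- exact: multilinear4_3 det4_multilinear _ _ _ _ _ _.
- exact: multilinear4_4 det4_multilinear _ _ _ _ _ _.
- exact: (@det4_alternate _ _ _ _ (@Ordinal 4 2 isT) (@Ordinal 4 3 isT)).
Qed.

End Det4.

Lemma sum4 (V : nmodType) (F : 'I_4 -> V) :
  \sum_i F i = F (@Ordinal 4 0 isT) + F (@Ordinal 4 1 isT)
    + F (@Ordinal 4 2 isT) + F (@Ordinal 4 3 isT).
Proof.
rewrite !big_ord_recl big_ord0 addr0 !addrA.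
by congr (F _ + F _ + F _ + F _); apply: val_inj.
Qed.

Lemma sum6 (V : nmodType) (F : 'I_6 -> V) :
  \sum_i F i = F (@Ordinal 6 0 isT) + F (@Ordinal 6 1 isT) + F (@Ordinal 6 2 isT)
    + F (@Ordinal 6 3 isT) + F (@Ordinal 6 4 isT) + F (@Ordinal 6 5 isT).
Proof.
rewrite !big_ord_recl big_ord0 addr0 !addrA.
by congr (F _ + F _ + F _ + F _ + F _ + F _); apply: val_inj.
Qed.

(** * The basis of coordinate planes of an oriented orthonormal frame *)

Section PlaneBasis.
Context {R : realType} {M : oriented_manifold R 4}.
Variables (h : metric M) (p : M).
Implicit Types (v w x y : 'rV[R]_4) (xi eta zeta : bivector R 4).

Local Notation inner := (bivector_inner h p).

Lemma metric_multilinear :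
  multilinear4 (fun v w x y => h p v x * h p w y - h p v y * h p w x).
Proof.
by split=> a u v w x y; rewrite ?inner_linear ?(innerC h p w) ?(innerC h p x) ?inner_linear; ring.
Qed.

Lemma bivector_inner_wedge v w x y :
  inner (wedge v w) (wedge x y) = h p v x * h p w y - h p v y * h p w x.
Proof.
apply: (bivector_form_wedge metric_multilinear) => *; ring.
Qed.

Lemma bivector_innerC xi eta : inner xi eta = inner eta xi.
Proof.
apply: bivector_formC => v w x y.
by rewrite (innerC h p x) (innerC h p y) (innerC h p x w) (innerC h p y v); ring.
Qed.

Lemma wedge4_wedge v w x y : wedge4 (wedge v w) (wedge x y) = det4 v w x y.
Proof.
rewrite wedge4E bivector_form_wedge //; first exact: det4_multilinear.
  exact: det4_anti12.
exact: det4_anti34.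
Qed.

Lemma bivector_form_suml T (I : Type) (r : seq I) (c : I -> R) (b : I -> bivector R 4) eta :
  bivector_form T (\sum_(i <- r) c i *: b i) eta =
    \sum_(i <- r) c i * bivector_form T (b i) eta.
Proof.
elim: r => [|i r IH]; last by rewrite !big_cons bivector_form_linear1 IH.
rewrite !big_nil; have := bivector_form_linear1 T (-1) 0 0 eta.
by rewrite scaler0 addr0 mulN1r addNr.
Qed.

Lemma bivector_form_sumr T (I : Type) (r : seq I) (c : I -> R) (b : I -> bivector R 4) eta :
  bivector_form T eta (\sum_(i <- r) c i *: b i) =
    \sum_(i <- r) c i * bivector_form T eta (b i).
Proof.
elim: r => [|i r IH]; last by rewrite !big_cons bivector_form_linear2 IH.
rewrite !big_nil; have := bivector_form_linear2 T (-1) 0 0 eta.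
by rewrite scaler0 addr0 mulN1r addNr.
Qed.

Lemma bivector_formZl T (a : R) xi eta :
  bivector_form T (a *: xi) eta = a * bivector_form T xi eta.
Proof.
by have := bivector_form_suml T [:: tt] (fun=> a) (fun=> xi) eta; rewrite !big_seq1.
Qed.

Local Notation o0 := (@Ordinal 4 0 isT).
Local Notation o1 := (@Ordinal 4 1 isT).
Local Notation o2 := (@Ordinal 4 2 isT).
Local Notation o3 := (@Ordinal 4 3 isT).

(* The coordinate planes are listed as 01, 02, 03, 23, 31, 12: the Hodge star
   of the [k]-th one is the [k + 3 mod 6]-th one. *)
Definition plane_fst (k : 'I_6) : 'I_4 := nth o0 [:: o0; o0; o0; o2; o3; o1] k.
Definition plane_snd (k : 'I_6) : 'I_4 := nth o0 [:: o1; o2; o3; o3; o1; o2] k.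
Definition dual_plane (k : 'I_6) : 'I_6 := inZp (k + 3).

Lemma dual_planeK : involutive dual_plane.
Proof. by case=> [[|[|[|[|[|[|k]]]]]] hk] //; apply: val_inj. Qed.

Variable e : 'I_4 -> 'rV[R]_4.
Hypothesis he : oriented_orthonormal h p e.

Definition plane (k : 'I_6) : bivector R 4 := wedge (e (plane_fst k)) (e (plane_snd k)).

Lemma inner_plane i j : inner (plane i) (plane j) = (i == j)%:R.
Proof.
rewrite bivector_inner_wedge !he.1.
case: i => [[|[|[|[|[|[|i]]]]]] hi] //; case: j => [[|[|[|[|[|[|j]]]]]] hj] //;
 rewrite /plane_fst /plane_snd -!val_eqE /=; ring.
Qed.

Definition frame_mx : 'M[R]_4 := \matrix_i e i.

Lemma det4_frame : det4 (e o0) (e o1) (e o2) (e o3) = \det frame_mx.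
Proof.
congr (\det _); apply/matrixP => i j; rewrite !mxE.
by case: i => [[|[|[|[|i]]]] hi] //=; congr (e _ _ _); apply: val_inj.
Qed.

(** Because the fifth plane is 31 and not 13, a plane followed by its dual always lists the frame
    vectors in an even permutation, so no sign occurs. All other pairs repeat a vector. *)
Lemma wedge4_plane i j :
  wedge4 (plane i) (plane j) = (j == dual_plane i)%:R * \det frame_mx.
Proof.
rewrite wedge4_wedge -det4_frame.
have alt := @det4_alternate R.
have a01 v x y : det4 v v x y = 0 by exact: (alt _ _ _ _ o0 o1).
have a02 v x y : det4 v x v y = 0 by exact: (alt _ _ _ _ o0 o2).
have a03 v x y : det4 v x y v = 0 by exact: (alt _ _ _ _ o0 o3).
have a12 v x y : det4 x v v y = 0 by exact: (alt _ _ _ _ o1 o2).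
have a13 v x y : det4 x v y v = 0 by exact: (alt _ _ _ _ o1 o3).
have a23 v x y : det4 x y v v = 0 by exact: (alt _ _ _ _ o2 o3).
case: i => [[|[|[|[|[|[|i]]]]]] hi] //; case: j => [[|[|[|[|[|[|j]]]]]] hj] //;
 rewrite /plane_fst /plane_snd -!val_eqE /= ?mul0r ?mul1r ?a02 ?a03 ?a12 ?a13 //.
- by rewrite det4_anti34 det4_anti23 opprK.
- by rewrite det4_anti23 det4_anti34 opprK.
- rewrite (det4_anti23 (e o2)) (det4_anti12 (e o2)) opprK.
  by rewrite (det4_anti34 (e o0)) (det4_anti23 (e o0)) opprK.
- rewrite (det4_anti23 (e o3)) (det4_anti12 (e o3)) opprK.
  by rewrite (det4_anti23 (e o0)) (det4_anti34 (e o0)) opprK.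
- by rewrite (det4_anti23 (e o1)) (det4_anti12 (e o1)) opprK.
Qed.

Lemma det_frame_gt0 : 0 < \det frame_mx.
Proof. exact: he.2. Qed.

(** Orthonormality says that the frame matrix conjugates the Gram matrix [G] to the identity, so
    [\det G] is the inverse square of [\det frame_mx]; the orientation selects the positive root. *)
Lemma dV_frame : dV h p = \det frame_mx.
Proof.
rewrite /dV; set G := \matrix_(i, j) _.
have l1 w a u v : h p (a *: u + v) w = a * h p u w + h p v w by exact: inner_linear.
have l2 w a u v : h p w (a *: u + v) = a * h p w u + h p w v.
  by rewrite !(innerC h p w) inner_linear.
have E : frame_mx *m G *m frame_mx^T = 1%:M.
  apply/matrixP => i j; rewrite [RHS]mxE -he.1 (functional_sum (l1 (e j)) (e i)).
  rewrite -mulmxA mxE; apply: eq_bigr => k _; rewrite !mxE; congr (_ * _).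
  rewrite (functional_sum (l2 _) (e j)); apply: eq_bigr => l _.
  by rewrite !mxE mulrC.
have d0 := det_frame_gt0.
have {}E : \det G = (\det frame_mx)^-1 ^+ 2.
  have := congr1 determinant E; rewrite !det_mulmx det_tr det1 => D.
  apply: (@mulfI _ (\det frame_mx ^+ 2)); first by rewrite expf_neq0 // gt_eqF.
  by rewrite -exprMn mulfV ?gt_eqF // expr1n -D; ring.
by rewrite E sqrtr_sqr gtr0_norm ?invr_gt0 // invrK.
Qed.

Lemma plane_span xi : exists c : 'I_6 -> R, xi = \sum_k c k *: plane k.
Proof.
pose F := invmx frame_mx.
have uE : frame_mx \in unitmx by rewrite unitmxE unitfE gt_eqF // det_frame_gt0.
(* The matrix of [xi] relative to the frame; being antisymmetric, it is determined by its entries at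
   the six planes. *)
pose B := F^T *m xi *m F.
have xiE : xi = frame_mx^T *m B *m frame_mx :> 'M[R]_4.
  rewrite /B !mulmxA -trmx_mul mulVmx // trmx1 mul1mx -mulmxA mulVmx //.
  by rewrite mulmx1.
have aB i j : B j i = - B i j.
  have aX : (xi : 'M[R]_4)^T = - (xi : 'M[R]_4).
    by case: (xi) => m hm /=; have := hm; rewrite inE => /eqP.
  have : B^T = - B by rewrite /B !trmx_mul trmxK aX mulNmx mulmxN mulmxA.
  by move=> /matrixP/(_ i j); rewrite !mxE.
have dB i : B i i = 0.
  have := aB i i; move/eqP; rewrite -subr_eq0 opprK -mulr2n mulrn_eq0 /=.
  by move/eqP.
exists (fun k => B (plane_fst k) (plane_snd k)).
apply: val_inj; rewrite [LHS]/= xiE; apply/matrixP => r s.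
have -> : val (\sum_k B (plane_fst k) (plane_snd k) *: plane k) =
    \sum_k B (plane_fst k) (plane_snd k) *: (plane k : 'M[R]_4).
  by rewrite raddf_sum.
rewrite summxE; under [RHS]eq_bigr => k _ do rewrite mxE wedgeE.
have -> : (frame_mx^T *m B *m frame_mx) r s =
    \sum_j (\sum_i e i 0 r * B i j) * e j 0 s.
  rewrite mxE; apply: eq_bigr => j _; rewrite !mxE; congr (_ * _).
  by apply: eq_bigr => i _; rewrite !mxE.
rewrite !sum4 sum6 /plane_fst /plane_snd /= !dB.
rewrite (aB o0 o1) (aB o0 o2) (aB o0 o3) (aB o2 o3) (aB o3 o1) (aB o1 o2).
ring.
Qed.

End PlaneBasis.

(** * Existence of oriented orthonormal frames *)

Section FrameExistence.
Context {R : realType} {n : nat} {M : oriented_manifold R n}.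
Variables (h : metric M) (p : M).

(** A nonzero vector orthogonal to [k] given ones lies in the kernel of a matrix with [n] rows and
    [k < n] columns; it only has to be normalized, without the Gram-Schmidt process. *)
Lemma orthonormal_family k : (k <= n)%N -> exists e : 'I_k -> 'rV[R]_n,
  forall i j, h p (e i) (e j) = (i == j)%:R.
Proof.
elim: k => [|k IH] kn; first by exists (fun=> 0) => -[].
have [e he] := IH (ltnW kn).
pose A := \matrix_(i < n, j < k) h p (delta_mx 0 i) (e j).
have [v vA v0] : exists2 v : 'rV[R]_n, v *m A = 0 & v != 0.
  have : kermx A != 0.
    rewrite kermx_eq0 /row_free neq_ltn (leq_ltn_trans (rank_leq_col A)) //.
  move=> /rowV0Pn[v /sub_kermxP vA v0]; by exists v.
have hv j : h p v (e j) = 0.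
  have := congr1 (fun m => (m : 'rV[R]_k) 0 j) vA; rewrite /= [RHS]mxE => <-.
  rewrite (functional_sum (fun a u w => inner_linear h p a u w (e j)) v) mxE.
  by apply: eq_bigr => i _; rewrite mxE.
pose c := (Num.sqrt (h p v v))^-1.
have hvv := inner_gt0 h p v0.
have hZ a u w : h p (a *: u) w = a * h p u w.
  have := inner_linear h p a u 0 w; have := inner_linear h p (-1) 0 0 w.
  by rewrite scaler0 !addr0 mulN1r addNr => ->; rewrite addr0.
have hcv u : h p (c *: v) u = c * h p v u by exact: hZ.
exists (fun i => if unlift ord_max i is Some j then e j else c *: v) => i j.
case: unliftP => [i' ->|->]; case: unliftP => [j' ->|->].
- by rewrite he (inj_eq lift_inj).
- by rewrite innerC hcv hv mulr0 eq_sym (negbTE (neq_lift _ _)).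
- by rewrite hcv hv mulr0 (negbTE (neq_lift _ _)).
- rewrite eqxx hcv innerC hcv mulrA -expr2 exprVn sqr_sqrtr ?ltW //.
  by rewrite mulVf // gt_eqF.
Qed.

End FrameExistence.

(** The squared norm of a combination of orthonormal vectors is the sum of the squares of its
    coefficients, so the determinant is nonzero. If it is negative, the signs [s] reverse the first
    vector. *)
Lemma oriented_frame (R : realType) (M : oriented_manifold R 4) (h : metric M) (p : M) :
  exists e, oriented_orthonormal h p e.
Proof.
have [e he] := orthonormal_family h p (leqnn 4).
pose E := frame_mx e.
have hZ a u w : h p (a *: u) w = a * h p u w.
  have := inner_linear h p a u 0 w; have := inner_linear h p (-1) 0 0 w.
  by rewrite scaler0 !addr0 mulN1r addNr => ->; rewrite addr0.
pose s (i : 'I_4) : R := if i == ord0 then -1 else 1.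
have sE : \matrix_i (s i *: e i) = diag_mx (\row_i s i) *m E.
  by apply/matrixP => i j; rewrite mul_diag_mx !mxE.
have ds : \det (diag_mx (\row_i s i)) = -1.
  rewrite det_diag (bigD1 ord0) //= mxE /s eqxx big1 ?mulr1 // => i /negbTE i0.
  by rewrite mxE i0.
have hs i j : h p (s i *: e i) (s j *: e j) = (i == j)%:R.
  rewrite hZ innerC hZ he eq_sym; have [->|_] := eqVneq i j; last by rewrite !mulr0.
  by rewrite mulr1 /s; case: ifP => _; rewrite ?mulr1 ?mulrNN ?mulr1.
have dE : \det E != 0.
  apply/eqP => /eqP /det0P[v v0 vE].
  have hv : h p (\sum_i v 0 i *: e i) (\sum_i v 0 i *: e i) = \sum_i v 0 i * v 0 i.
    rewrite inner_suml; apply: eq_bigr => i _; rewrite inner_sumr (bigD1 i) //= he eqxx.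
    rewrite mulr1 big1 ?addr0 // => j ji.
    by rewrite he eq_sym (negbTE ji) mulr0.
  have z : \sum_i v 0 i *: e i = 0.
    apply: etrans _ vE; rewrite mulmx_sum_row; apply: eq_bigr => i _; congr (_ *: _).
    by apply/rowP => j; rewrite !mxE.
  have : h p 0 0 = 0.
    have := inner_linear h p (-1) 0 0 0.
    by rewrite scaler0 !addr0 mulN1r addNr.
  rewrite -[X in h p X X]z hv => /eqP; rewrite psumr_eq0; last first.
    by move=> i _; rewrite -expr2 sqr_ge0.
  move=> /allP V; move/negP: v0; apply; apply/eqP/rowP => i.
  have := V i; rewrite mem_index_enum => /(_ isT) /=.
  by rewrite mulf_eq0 orbb mxE => /eqP.
have [d|d] := ltP 0 (\det E); first by exists e.
exists (fun i => s i *: e i); split; first exact: hs.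
rewrite sE det_mulmx ds mulN1r oppr_gt0 lt_neqAle d andbT.
exact: dE.
Qed.

(** * The Hodge star in coordinates *)

Section HodgeStar.
Context {R : realType} {M : oriented_manifold R 4}.
Variables (h : metric M) (p : M) (e : 'I_4 -> 'rV[R]_4).
Hypothesis he : oriented_orthonormal h p e.
Implicit Types (xi eta zeta : bivector R 4).

Local Notation inner := (bivector_inner h p).
Local Notation hodge := (hodge h p).
Local Notation w := (plane e).

Lemma bivector_inner_suml (I : Type) (r : seq I) (c : I -> R) (b : I -> bivector R 4) eta :
  inner (\sum_(i <- r) c i *: b i) eta = \sum_(i <- r) c i * inner (b i) eta.
Proof. exact: bivector_form_suml. Qed.

Lemma bivector_inner_sumr (I : Type) (r : seq I) (c : I -> R) (b : I -> bivector R 4) eta :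
  inner eta (\sum_(i <- r) c i *: b i) = \sum_(i <- r) c i * inner eta (b i).
Proof. exact: bivector_form_sumr. Qed.

Lemma inner_plane_coord c j : inner (\sum_k c k *: w k) (w j) = c j.
Proof.
rewrite bivector_inner_suml (bigD1 j) //=.
rewrite (inner_plane he) eqxx mulr1 big1 ?addr0 // => k kj.
by rewrite (inner_plane he) (negbTE kj) mulr0.
Qed.

Lemma plane_expand xi : xi = \sum_k inner xi (w k) *: w k.
Proof.
have [c ->] := plane_span he xi; apply: eq_bigr => k _.
by rewrite inner_plane_coord.
Qed.

Lemma bivector_inner_inj xi eta : (forall k, inner xi (w k) = inner eta (w k)) -> xi = eta.
Proof.
move=> E; rewrite (plane_expand xi) (plane_expand eta).
by apply: eq_bigr => k _; rewrite E.
Qed.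

Lemma bivector_form_riesz T xi :
  {zeta | forall eta, inner zeta eta = bivector_form T xi eta}.
Proof.
exists (\sum_k bivector_form T xi (w k) *: w k) => eta.
rewrite [in LHS](plane_expand eta) [in RHS](plane_expand eta).
rewrite bivector_form_sumr bivector_inner_sumr.
by apply: eq_bigr => k _; rewrite inner_plane_coord.
Qed.

Lemma wedge4_coord c j :
  wedge4 (w j) (\sum_k c k *: w k) = \det (frame_mx e) * c (dual_plane j).
Proof.
rewrite wedge4E bivector_form_sumr (bigD1 (dual_plane j)) //= -wedge4E.
rewrite (wedge4_plane e) eqxx mul1r mulrC big1 ?addr0 // => k kj.
by rewrite -wedge4E (wedge4_plane e) (negbTE kj) mul0r mulr0.
Qed.

(** The witness permutes the coordinates of [eta] by [dual_plane]; the determinant produced by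
    [wedge4] is the factor [dV] of the definition. *)
Lemma hodgeP eta xi : wedge4 xi (hodge eta) = inner xi eta * dV h p.
Proof.
rewrite /Defs.hodge; case: xgetP => [z _ /(_ xi)//|no].
case: (no (\sum_k inner eta (w (dual_plane k)) *: w k)) => zeta.
rewrite [in LHS](plane_expand zeta) [in RHS](plane_expand zeta) wedge4E.
rewrite bivector_form_suml bivector_inner_suml mulr_suml.
apply: eq_bigr => j _; rewrite -wedge4E wedge4_coord.
rewrite dual_planeK (dV_frame he) (bivector_innerC h p (w j)).
by rewrite -mulrA [\det _ * _]mulrC.
Qed.

(** Wedging with the dual plane reads off the [k]-th coordinate up to a nonzero determinant. The
    star is therefore a permutation of coordinates, from which its symmetry, involutivity and
    linearity are deduced. *)
Lemma hodge_coord eta k : inner (hodge eta) (w k) = inner eta (w (dual_plane k)).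
Proof.
have := hodgeP eta (w (dual_plane k)); rewrite [in LHS](plane_expand (hodge eta)).
rewrite wedge4_coord dual_planeK (dV_frame he) => E.
apply: (mulfI (lt0r_neq0 (det_frame_gt0 he))).
by rewrite E bivector_innerC mulrC.
Qed.

Lemma hodge_sym xi eta : inner (hodge xi) eta = inner xi (hodge eta).
Proof.
rewrite [in LHS](plane_expand eta) [in RHS](plane_expand (hodge eta)) !bivector_inner_sumr.
rewrite (reindex_inj (inv_inj dual_planeK)) /=; apply: eq_bigr => k _.
by rewrite !hodge_coord dual_planeK.
Qed.

Lemma hodgeK : involutive hodge.
Proof. by move=> xi; apply: bivector_inner_inj => k; rewrite !hodge_coord dual_planeK. Qed.

Lemma hodge_linear a xi eta : hodge (a *: xi + eta) = a *: hodge xi + hodge eta.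
Proof.
apply: bivector_inner_inj => k; rewrite hodge_coord.
have L zeta b c : inner (a *: b + c) zeta = a * inner b zeta + inner c zeta.
  exact: bivector_form_linear1.
by rewrite !L !hodge_coord.
Qed.

Lemma hodgeZ a xi : hodge (a *: xi) = a *: hodge xi.
Proof.
apply: bivector_inner_inj => k; rewrite hodge_coord.
have L zeta b : inner (a *: b) zeta = a * inner b zeta by exact: bivector_formZl.
by rewrite !L !hodge_coord.
Qed.

Lemma hodge_plane k : hodge (w k) = w (dual_plane k).
Proof.
apply: bivector_inner_inj => j; rewrite hodge_coord !(inner_plane he).
by rewrite -(inj_eq (inv_inj dual_planeK)) dual_planeK.
Qed.

End HodgeStar.

(** * The four conditions *)

Lemma forall_ord4 (P : 'I_4 -> Prop) :
  P (@Ordinal 4 0 isT) -> P (@Ordinal 4 1 isT) -> P (@Ordinal 4 2 isT) ->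
  P (@Ordinal 4 3 isT) -> forall i, P i.
Proof.
move=> P0 P1 P2 P3 [[|[|[|[|i]]]] hi] //.
- by rewrite (bool_irrelevance hi isT).
- by rewrite (bool_irrelevance hi isT).
- by rewrite (bool_irrelevance hi isT).
- by rewrite (bool_irrelevance hi isT).
Qed.

Lemma forall_ord6 (P : 'I_6 -> Prop) :
  P (@Ordinal 6 0 isT) -> P (@Ordinal 6 1 isT) -> P (@Ordinal 6 2 isT) ->
  P (@Ordinal 6 3 isT) -> P (@Ordinal 6 4 isT) -> P (@Ordinal 6 5 isT) ->
  forall i, P i.
Proof.
move=> P0 P1 P2 P3 P4 P5 [[|[|[|[|[|[|i]]]]]] hi] //.
- by rewrite (bool_irrelevance hi isT).
- by rewrite (bool_irrelevance hi isT).
- by rewrite (bool_irrelevance hi isT).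
- by rewrite (bool_irrelevance hi isT).
- by rewrite (bool_irrelevance hi isT).
- by rewrite (bool_irrelevance hi isT).
Qed.

(** * Ricci traces and dual planes, for an abstract array of curvature components *)

Section RicciDual.
Context {R : realType}.
Variable T : 'I_4 -> 'I_4 -> 'I_4 -> 'I_4 -> R.
Hypothesis a12 : forall i j k l, T i j k l = - T j i k l.
Hypothesis a34 : forall i j k l, T i j k l = - T i j l k.
Hypothesis pair : forall i j k l, T i j k l = T k l i j.

Let A i j := T (plane_fst i) (plane_snd i) (plane_fst j) (plane_snd j).
Let ric j l := \sum_i T i j l i.
Let scal := \sum_j ric j j.

Local Notation o0 := (@Ordinal 4 0 isT).
Local Notation o1 := (@Ordinal 4 1 isT).
Local Notation o2 := (@Ordinal 4 2 isT).
Local Notation o3 := (@Ordinal 4 3 isT).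
Local Notation k0 := (@Ordinal 6 0 isT).
Local Notation k1 := (@Ordinal 6 1 isT).
Local Notation k2 := (@Ordinal 6 2 isT).
Local Notation k3 := (@Ordinal 6 3 isT).
Local Notation k4 := (@Ordinal 6 4 isT).
Local Notation k5 := (@Ordinal 6 5 isT).

Let AC i j : A i j = A j i. Proof. exact: pair. Qed.

Let T0 i k l : T i i k l = 0. Proof. have := a12 i i k l; lra. Qed.
Let T0' i k l : T k l i i = 0. Proof. by rewrite pair T0. Qed.

(** A diagonal entry collects the three planes containing its index, with a minus sign because the
    trace is of [T i j l i]. Off the diagonal two terms survive, and they compare a pair of planes
    with the dual pair, up to the symmetry of [A]. *)
Let ricE :
  [/\ [/\ ric o0 o0 = - (A k0 k0 + A k1 k1 + A k2 k2),
      ric o1 o1 = - (A k0 k0 + A k4 k4 + A k5 k5),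
      ric o2 o2 = - (A k1 k1 + A k3 k3 + A k5 k5) &
      ric o3 o3 = - (A k2 k2 + A k3 k3 + A k4 k4)],
      [/\ ric o0 o1 = A k2 k4 - A k1 k5, ric o0 o2 = A k0 k5 - A k2 k3 &
      ric o0 o3 = A k1 k3 - A k0 k4],
      [/\ ric o1 o2 = A k3 k4 - A k0 k1, ric o1 o3 = A k3 k5 - A k0 k2 &
      ric o2 o3 = A k4 k5 - A k1 k2] & forall i j, ric i j = ric j i].
Proof.
have ricC i j : ric i j = ric j i.
  by apply: eq_bigr => k _; rewrite pair a12 a34 opprK.
split=> //; split; rewrite /ric sum4 ?T0 ?T0' /A /plane_fst /plane_snd /=.
- rewrite (a12 o1 o0) (a12 o2 o0) (a12 o3 o0); ring.
- rewrite (a34 o0 o1 o1 o0) (a12 o2 o1) (a34 _ _ o1 o3); ring.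
- rewrite (a34 o0 o2 o2 o0) (a34 o1 o2 o2 o1) (a12 o3 o2); ring.
- rewrite (a34 o0 o3 o3 o0) (a12 o1 o3) (a34 o2 o3 o3 o2); ring.
- rewrite (a12 o2 o0) (a12 o3 o0) (a34 _ _ o1 o3); ring.
- rewrite (a12 o1 o0) (a34 _ _ o2 o1) (a12 o3 o0); ring.
- rewrite (a12 o1 o0) (a12 o2 o0) (a34 _ _ o3 o2); ring.
- rewrite (a34 _ _ o2 o0) (pair o3 o1); ring.
- rewrite (a34 _ _ o3 o0) (a34 _ _ o3 o2) (a12 o2 o1) (pair o1 o2); ring.
- rewrite (a34 _ _ o3 o0) (pair o1 o2); ring.
Qed.

Let d0 : dual_plane k0 = k3. Proof. exact: val_inj. Qed.
Let d1 : dual_plane k1 = k4. Proof. exact: val_inj. Qed.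
Let d2 : dual_plane k2 = k5. Proof. exact: val_inj. Qed.
Let d3 : dual_plane k3 = k0. Proof. exact: val_inj. Qed.
Let d4 : dual_plane k4 = k1. Proof. exact: val_inj. Qed.
Let d5 : dual_plane k5 = k2. Proof. exact: val_inj. Qed.

(** Each index lies in exactly one plane of every dual couple, so the diagonal hypothesis makes all
    diagonal Ricci entries equal; the six other hypotheses kill the off-diagonal ones. *)
Lemma einstein_of_dual :
  (forall i, A i i = A (dual_plane i) (dual_plane i)) ->
  A k0 k1 = A (dual_plane k0) (dual_plane k1) ->
  A k0 k2 = A (dual_plane k0) (dual_plane k2) ->
  A k1 k2 = A (dual_plane k1) (dual_plane k2) ->
  A k0 k4 = A (dual_plane k0) (dual_plane k4) ->
  A k0 k5 = A (dual_plane k0) (dual_plane k5) ->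
  A k1 k5 = A (dual_plane k1) (dual_plane k5) ->
  forall j l, ric j l = scal / 4 * (j == l)%:R.
Proof.
have [[r00 r11 r22 r33] [r01 r02 r03] [r12 r13 r23] ricC] := ricE.
have scalE : scal = ric o0 o0 + ric o1 o1 + ric o2 o2 + ric o3 o3 by exact: sum4.
clearbody scal ric A.
move=> H; move: (H k0) (H k1) (H k2).
rewrite d0 d1 d2 d4 d5 (AC k3 k1) (AC k3 k2) (AC k4 k2).
move=> h1 h2 h3 h4 h5 h6 h7 h8 h9.
apply: forall_ord4; apply: forall_ord4;
  rewrite ?(ricC o1 o0) ?(ricC o2 o0) ?(ricC o3 o0) ?(ricC o2 o1)
    ?(ricC o3 o1) ?(ricC o3 o2) scalE -!val_eqE /= ?mulr1 ?mulr0
    ?r00 ?r11 ?r22 ?r33 ?r01 ?r02 ?r03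
    ?r12 ?r13 ?r23 ?h1 ?h2 ?h3 ?h4 ?h5 ?h6 ?h7 ?h8 ?h9; lra.
Qed.

Lemma dual_of_einstein : (forall j l, ric j l = scal / 4 * (j == l)%:R) ->
  forall i j, A i j = A (dual_plane i) (dual_plane j).
Proof.
move=> H.
have [[r00 r11 r22 r33] [r01 r02 r03] [r12 r13 r23] ricC] := ricE.
have scalE : scal = ric o0 o0 + ric o1 o1 + ric o2 o2 + ric o3 o3 by exact: sum4.
clearbody scal ric A.
have := (H o0 o0, H o1 o1, H o2 o2, H o3 o3, H o0 o1, H o0 o2, H o0 o3, H o1 o2, H o1 o3, H o2 o3).
rewrite scalE -!val_eqE /= ?mulr1 ?mulr0 r00 r11 r22 r33 r01 r02 r03 r12 r13 r23.
move=> [[[[[[[[[h1 h2] h3] h4] h5] h6] h7] h8] h9] h10].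
(* In [ric o0 o0 + ric o1 o1 = ric o2 o2 + ric o3 o3] the four planes other than 01 and 23 cancel;
   the next two equalities come from the other splittings of the indices into pairs. *)
have e1 : A k0 k0 = A k3 k3 by lra.
have e2 : A k1 k1 = A k4 k4 by lra.
have e3 : A k2 k2 = A k5 k5 by lra.
have e4 : A k0 k1 = A k3 k4 by exact: esym (subr0_eq h8).
have e5 : A k0 k2 = A k3 k5 by exact: esym (subr0_eq h9).
have e6 : A k1 k2 = A k4 k5 by exact: esym (subr0_eq h10).
have e7 : A k0 k4 = A k1 k3 by exact: esym (subr0_eq h7).
have e8 : A k0 k5 = A k2 k3 by exact: subr0_eq h6.
have e9 : A k1 k5 = A k2 k4 by exact: esym (subr0_eq h5).
apply: forall_ord6; apply: forall_ord6; rewrite ?d0 ?d1 ?d2 ?d3 ?d4 ?d5;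
  rewrite ?(AC k1 k0) ?(AC k2 k0) ?(AC k3 k0) ?(AC k4 k0) ?(AC k5 k0)
  ?(AC k2 k1) ?(AC k3 k1) ?(AC k4 k1) ?(AC k5 k1) ?(AC k3 k2) ?(AC k4 k2) ?(AC k5 k2)
  ?(AC k4 k3) ?(AC k5 k3) ?(AC k5 k4) ?e1 ?e2 ?e3 ?e4 ?e5 ?e6 ?e7 ?e8 ?e9 //.
Qed.

End RicciDual.

(** * The implications at one point *)

Section MixedCurvature.
Context {R : realType} {M : oriented_manifold R 4}.
Variables (g h : metric M) (nabla : vfield M -> vfield M -> vfield M).
Hypothesis LC : levi_civita g nabla.
Variables (p : M) (e : 'I_4 -> 'rV[R]_4).
Hypothesis he : oriented_orthonormal h p e.
Implicit Types (xi eta zeta : bivector R 4).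

Local Notation inner := (bivector_inner h p).
Local Notation star := (hodge h p).
Local Notation F := (Rm_form g nabla p).
Local Notation op := (mixed_curvature_op h g nabla p).
Local Notation w := (plane e).

Lemma Rm_multilinear : multilinear4 (Rm g nabla p).
Proof.
split=> *; [exact: Rm_linear1|exact: Rm_linear2|exact: Rm_linear3|exact: Rm_linear4].
Qed.

Lemma Rm_formC xi eta : F xi eta = F eta xi.
Proof. exact/bivector_formC/Rm_pair. Qed.

Lemma Rm_form_lin a xi eta zeta : F (a *: xi + eta) zeta = a * F xi zeta + F eta zeta.
Proof. exact: bivector_form_linear1. Qed.

Lemma Rm_form_wedge (v w x y : 'rV[R]_4) : F (wedge v w) (wedge x y) = Rm g nabla p v w x y.
Proof.
apply: bivector_form_wedge; [exact: Rm_multilinear|exact: Rm_anti12|exact: Rm_anti34].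
Qed.

Lemma mixed_curvature_opP xi eta : inner (op xi) eta = F xi eta.
Proof.
rewrite /mixed_curvature_op; case: xgetP => [z _ /(_ eta)//|no].
have [zeta hz] := bivector_form_riesz he (Rm g nabla p) xi.
by case: (no zeta).
Qed.

(** The hypothesis is tested on [xi + star xi] and [eta - star eta], then with [xi] and [eta]
    exchanged. In the sum of the two equations the terms with a single star cancel by the symmetry
    of [F]. *)
Lemma hodge_invariant_of_orthogonal :
  (forall xi eta, self_dual h p xi -> anti_self_dual h p eta -> F xi eta = 0) ->
  forall xi eta, F (star xi) (star eta) = F xi eta.
Proof.
move=> H xi eta.
have sd zeta : self_dual h p (1 *: zeta + star zeta).
  by rewrite /self_dual (hodge_linear he) (hodgeK he) !scale1r addrC.
have asd zeta : anti_self_dual h p ((-1) *: star zeta + zeta).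
  by rewrite /anti_self_dual (hodge_linear he) (hodgeK he) !scaleN1r opprD opprK addrC.
have := H _ _ (sd xi) (asd eta); have := H _ _ (sd eta) (asd xi).
rewrite !Rm_form_lin ![F _ (_ *: _ + _)]Rm_formC !Rm_form_lin.
rewrite (Rm_formC eta xi) (Rm_formC (star eta) (star xi)) (Rm_formC eta (star xi)).
rewrite (Rm_formC xi (star eta)); lra.
Qed.

Lemma hodge_commute_of_invariant :
  (forall xi eta, F (star xi) (star eta) = F xi eta) ->
  forall xi, star (op xi) = op (star xi).
Proof.
move=> H xi; apply: (bivector_inner_inj he) => k.
rewrite (hodge_sym he) !mixed_curvature_opP.
by rewrite -[in LHS]H (hodgeK he).
Qed.

Lemma mixed_sec_hodge_of_commute :
  (forall xi, star (op xi) = op (star xi)) ->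
  forall P, mixed_sec h g nabla p P = mixed_sec h g nabla p (star P).
Proof. by move=> H P; rewrite /mixed_sec -H (hodge_sym he) (hodgeK he). Qed.

Local Notation o0 := (@Ordinal 4 0 isT).
Local Notation o1 := (@Ordinal 4 1 isT).
Local Notation o2 := (@Ordinal 4 2 isT).
Local Notation o3 := (@Ordinal 4 3 isT).
Local Notation k0 := (@Ordinal 6 0 isT).
Local Notation k1 := (@Ordinal 6 1 isT).
Local Notation k2 := (@Ordinal 6 2 isT).
Local Notation k4 := (@Ordinal 6 4 isT).
Local Notation k5 := (@Ordinal 6 5 isT).

(** The six pairs represent the couples exchanged by the star among pairs of planes sharing a
    direction. A plane and its dual share none, but there the equality is already the symmetry of
    [F]. *)
Lemma planes_of_mixed_sec
  (E := fun i j => F (w i) (w j) = F (w (dual_plane i)) (w (dual_plane j))) :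
  (forall P, Gr2 h p P -> mixed_sec h g nabla p P = mixed_sec h g nabla p (star P)) ->
  [/\ forall i, F (w i) (w i) = F (w (dual_plane i)) (w (dual_plane i)),
      [/\ E k0 k1, E k0 k2 & E k1 k2] & [/\ E k0 k4, E k0 k5 & E k1 k5]].
Proof.
move=> H; have {}H P : Gr2 h p P -> F P P = F (star P) (star P).
  by move=> /H; rewrite /mixed_sec !mixed_curvature_opP.
have diag i : F (w i) (w i) = F (w (dual_plane i)) (w (dual_plane i)).
  rewrite -(hodge_plane he); apply: H; split; first by exists (e (plane_fst i)), (e (plane_snd i)).
  by rewrite (inner_plane he) eqxx.
have off i j v u : i != j -> w i + w j = wedge v u ->
    F (w i) (w j) = F (w (dual_plane i)) (w (dual_plane j)).
  move=> ij ijE; pose c : R := (Num.sqrt 2)^-1.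
  have c2 : c * c = 2^-1 by rewrite -expr2 exprVn sqr_sqrtr.
  have E2 : c *: w i + c *: w j = wedge (c *: v) u by rewrite wedgeZl -ijE scalerDr.
  (* The same expansion serves twice: for the inner product, to see that the combination is a unit
     bivector, and for [F], to extract the mixed term. *)
  have q T : (forall xi eta, bivector_form T xi eta = bivector_form T eta xi) ->
     forall a b, bivector_form T (c *: a + c *: b) (c *: a + c *: b) =
      2^-1 * (bivector_form T a a + bivector_form T b b) + bivector_form T a b.
    move=> TC a b.
    rewrite bivector_form_linear1 bivector_formZl ![bivector_form T _ (c *: a + _)]TC.
    rewrite !bivector_form_linear1 !bivector_formZl (TC b a).
    rewrite [LHS](_ : _ = c * c * (bivector_form T a a + bivector_form T b b
       + 2 * bivector_form T a b)); last by ring.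
    by rewrite c2; field.
  have G : Gr2 h p (c *: w i + c *: w j).
    split; first by exists (c *: v), u.
    have -> : inner (c *: w i + c *: w j) (c *: w i + c *: w j) =
        2^-1 * (inner (w i) (w i) + inner (w j) (w j)) + inner (w i) (w j).
      exact: (q _ (bivector_innerC h p)).
    by rewrite !(inner_plane he) !eqxx (negbTE ij) /= addr0; field.
  have qF a b : F (c *: a + c *: b) (c *: a + c *: b) =
      2^-1 * (F a a + F b b) + F a b by exact: (q _ Rm_formC).
  have := H _ G; rewrite (hodge_linear he) (hodgeZ he) !(hodge_plane he).
  (* The diagonal equalities match the square terms on both sides, leaving the mixed ones. *)
  rewrite !qF (diag i) (diag j).
  by move=> /addrI.
split=> //; split.
- by apply: (off _ _ (e o0) (e o1 + e o2)) => //; rewrite wedgeDr.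
- by apply: (off _ _ (e o0) (e o1 + e o3)) => //; rewrite wedgeDr.
- by apply: (off _ _ (e o0) (e o2 + e o3)) => //; rewrite wedgeDr.
- by apply: (off _ _ (e o0 + e o3) (e o1)) => //; rewrite wedgeDl.
- by apply: (off _ _ (e o0 - e o2) (e o1)) => //; rewrite wedgeDl wedgeNl.
- by apply: (off _ _ (e o0 + e o1) (e o2)) => //; rewrite wedgeDl.
Qed.

Lemma hodge_invariant_of_planes :
  (forall i j, F (w i) (w j) = F (w (dual_plane i)) (w (dual_plane j))) ->
  forall xi eta, F (star xi) (star eta) = F xi eta.
Proof.
move=> H xi eta; rewrite [in RHS](plane_expand he xi) [in RHS](plane_expand he eta).
rewrite [in LHS](plane_expand he (star xi)) [in LHS](plane_expand he (star eta)).
rewrite /Rm_form !bivector_form_suml (reindex_inj (inv_inj dual_planeK)) /=.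
apply: eq_bigr => i _; rewrite (hodge_coord he) dual_planeK; congr (_ * _).
rewrite !bivector_form_sumr (reindex_inj (inv_inj dual_planeK)) /=.
apply: eq_bigr => j _; rewrite (hodge_coord he) dual_planeK; congr (_ * _).
exact: esym (H i j).
Qed.

(** The star fixes [xi] and negates [eta], so [F xi eta] equals its own opposite. *)
Lemma orthogonal_of_hodge_invariant :
  (forall xi eta, F (star xi) (star eta) = F xi eta) ->
  forall xi eta, self_dual h p xi -> anti_self_dual h p eta -> F xi eta = 0.
Proof.
move=> H xi eta sd asd; have := H xi eta; rewrite sd asd Rm_formC.
have -> : F (- eta) xi = - F eta xi.
  by rewrite -scaleN1r -[RHS]mulN1r; exact: bivector_formZl.
rewrite (Rm_formC eta xi); lra.
Qed.

Let T i j k l := Rm g nabla p (e i) (e j) (e k) (e l).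

Let FwE i j : F (w i) (w j) =
  T (plane_fst i) (plane_snd i) (plane_fst j) (plane_snd j).
Proof. exact: Rm_form_wedge. Qed.

Lemma einstein_of_mixed_sec :
  (forall P, Gr2 h p P -> mixed_sec h g nabla p P = mixed_sec h g nabla p (star P)) ->
  forall j l, mixed_Ric g nabla p e j l = mixed_scal g nabla p e / 4 * h p (e j) (e l).
Proof.
move=> /planes_of_mixed_sec [diag [E01 E02 E12] [E04 E05 E15]] j l; rewrite he.1.
apply: (@einstein_of_dual _ T).
- by move=> *; exact: Rm_anti12.
- by move=> *; exact: Rm_anti34.
- by move=> *; exact: Rm_pair.
- by move=> i; rewrite -!FwE; exact: diag.
- by rewrite -!FwE; exact: E01.
- by rewrite -!FwE; exact: E02.
- by rewrite -!FwE; exact: E12.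
- by rewrite -!FwE; exact: E04.
- by rewrite -!FwE; exact: E05.
- by rewrite -!FwE; exact: E15.
Qed.

Lemma planes_of_einstein :
  (forall j l, mixed_Ric g nabla p e j l = mixed_scal g nabla p e / 4 * h p (e j) (e l)) ->
  forall i j, F (w i) (w j) = F (w (dual_plane i)) (w (dual_plane j)).
Proof.
move=> H i j; rewrite !FwE; apply: (@dual_of_einstein _ T).
- by move=> *; exact: Rm_anti12.
- by move=> *; exact: Rm_anti34.
- by move=> *; exact: Rm_pair.
- by move=> k l; rewrite -he.1; exact: H.
Qed.

End MixedCurvature.

(** The implications form a cycle in the order of the conditions and are proved point by point. The
    last condition is established for an arbitrary oriented orthonormal frame, but a single one,
    from [oriented_frame], suffices to return to the first. *)
Theorem proposition1 (R : realType) (M : oriented_manifold R 4)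
    (g h : metric M) (nabla : vfield M -> vfield M -> vfield M)
    (nabla_LC : levi_civita g nabla) :
  [<-> forall (p : M) (xi eta : bivector R 4),
         self_dual h p xi -> anti_self_dual h p eta ->
         Rm_form g nabla p xi eta = 0;
       forall (p : M) (xi : bivector R 4),
         hodge h p (mixed_curvature_op h g nabla p xi)
           = mixed_curvature_op h g nabla p (hodge h p xi);
       forall (p : M) (P : bivector R 4), Gr2 h p P ->
         mixed_sec h g nabla p P = mixed_sec h g nabla p (hodge h p P);
       forall (p : M) (e : 'I_4 -> 'rV[R]_4), oriented_orthonormal h p e ->
         forall j l : 'I_4,
           mixed_Ric g nabla p e j l
             = mixed_scal g nabla p e / 4 * h p (e j) (e l)].
Proof.
tfae=> [H p xi|H p P _|H p e he j l|H p].
- have [e he] := oriented_frame h p.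
  exact: hodge_commute_of_invariant he (hodge_invariant_of_orthogonal nabla_LC he (H p)) xi.
- have [e he] := oriented_frame h p.
  exact: mixed_sec_hodge_of_commute he (H p) P.
- by apply: (einstein_of_mixed_sec nabla_LC he) => P; exact: H.
- have [e he] := oriented_frame h p.
  apply: (orthogonal_of_hodge_invariant nabla_LC).
  exact: hodge_invariant_of_planes he (planes_of_einstein nabla_LC he (H p e he)).
Qed.
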